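(* Let $m\geq 5$ be an odd integer and put $\bar m:=m/2$. On $\mathbb{R}^3$ with coordinates $(x_1,x_2,x_3)$ consider the sub-Riemannian structure $(\Delta,g)$ for which the vector fields $$X^1=\partial_1,\qquad X^2=\partial_2+P(x)^2\,\partial_3,\qquad P(x)=x_1^2-x_2^m,$$ form an orthonormal frame of $\Delta$, and let $\bar\gamma(t):=(t^{\bar m},t,0)$ for $t\ge 0$. Then for every sufficiently small $\epsilon>0$, the curve $\bar\gamma|_{[0,\epsilon]}$ is, up to reparametrization, the unique horizontal path minimizing the distance between $\bar\gamma(0)$ and $\bar\gamma(\epsilon)$ with respect to $(\Delta,g)$; that is, $\mathrm{length}^g(\bar\gamma|_{[0,\epsilon]})=d_{SR}(\bar\gamma(0),\bar\gamma(\epsilon))$, and every horizontal path from $\bar\gamma(0)$ to $\bar\gamma(\epsilon)$ whose length equals $d_{SR}(\bar\gamma(0),\bar\gamma(\epsilon))$ coincides with $\bar\gamma|_{[0,\epsilon]}$ up to reparametrization. Furthermore, the arc length reparametrization of $\bar\gamma|_{[0,\epsilon]}$ is of class $C^{\bar m-1/2}$ but not of class $C^{\bar m+1/2}$.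
   Context: A horizontal path is an absolutely continuous curve $\gamma:[0,T]\to\mathbb{R}^3$ with $\dot\gamma(t)\in\Delta(\gamma(t))=\mathrm{span}\{X^1(\gamma(t)),X^2(\gamma(t))\}$ for almost every $t$, i.e. $\dot\gamma=u_1X^1(\gamma)+u_2X^2(\gamma)$ almost everywhere. Its length is $\mathrm{length}^g(\gamma)=\int_0^T|\dot\gamma(t)|_g\,dt=\int_0^T\sqrt{u_1(t)^2+u_2(t)^2}\,dt$. The sub-Riemannian distance $d_{SR}(x,y)$ is the infimum of the lengths of horizontal paths joining $x$ to $y$. The curve $\bar\gamma$ is horizontal. Since $m$ is odd, $\bar m\pm 1/2$ are integers. *)

(* Defs.v *)
From HB Require Import structures.
From mathcomp Require Import all_boot all_order all_algebra.
From mathcomp Require Import all_classical all_reals all_analysis.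
Set Implicit Arguments.
Unset Strict Implicit.
Unset Printing Implicit Defensive.
Import Order.TTheory GRing.Theory Num.Theory.
Import numFieldNormedType.Exports.
Local Open Scope classical_set_scope.
Local Open Scope ring_scope.

(* Curves on an interval [a, b] are total functions on R whose values outside
   [a, b] are irrelevant: every notion below only depends on the values of the
   curve on the interval. *)

(* Absolute continuity on [a, b], by the usual epsilon-delta condition on finite
   families of non-overlapping subintervals. *)
Definition absolutely_continuous (R : realType) (V : normedModType R)
    (a b : R) (f : R -> V) : Prop :=
  forall e : R, 0 < e -> exists2 d : R, 0 < d &
    forall (n : nat) (I : 'I_n -> R * R),
      (forall i, [/\ a <= (I i).1, (I i).1 <= (I i).2 & (I i).2 <= b]) ->
      trivIset [set: 'I_n] (fun i => `](I i).1, (I i).2[%classic) ->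
      \sum_(i < n) ((I i).2 - (I i).1) < d ->
      \sum_(i < n) `|f (I i).2 - f (I i).1| < e.

(* f has derivative l at x relative to [a, b] (so one-sided at an endpoint). *)
Definition has_derivative_within (R : realType) (V : normedModType R)
    (a b : R) (f : R -> V) (x : R) (l : V) : Prop :=
  (y - x)^-1 *: (f y - f x) @[y --> within `[a, b] x^'] --> l.

Fixpoint class_C (R : realType) (V : normedModType R)
    (k : nat) (a b : R) (f : R -> V) : Prop :=
  if k is k'.+1 then
    exists2 g : R -> V,
      (forall x : R, x \in `[a, b] -> has_derivative_within a b f x (g x)) &
      class_C k' a b g
  else {within `[a, b], continuous f}.

Definition vec3 (R : realType) (a b c : R) : 'rV[R]_3 :=
  \row_(i < 3) [:: a; b; c]`_i.

(* The rank-two sub-Riemannian structure (Delta, g) on R^3 for which the vector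
   fields X1 and X2 are an orthonormal frame of Delta. *)

Definition distribution_span (R : realType) (X1 X2 : 'rV[R]_3 -> 'rV[R]_3)
    (x : 'rV[R]_3) : set 'rV[R]_3 :=
  [set v | exists u : R * R, v = u.1 *: X1 x + u.2 *: X2 x].

(* The coordinates of v in Delta(x); unique when X1 x and X2 x are independent,
   and (0, 0) by convention when v is not in Delta(x). *)
Definition frame_coord (R : realType) (X1 X2 : 'rV[R]_3 -> 'rV[R]_3)
    (x v : 'rV[R]_3) : R * R :=
  xget (0, 0) [set u : R * R | v = u.1 *: X1 x + u.2 *: X2 x].

Definition sr_metric (R : realType) (X1 X2 : 'rV[R]_3 -> 'rV[R]_3)
    (x v w : 'rV[R]_3) : R :=
  (frame_coord X1 X2 x v).1 * (frame_coord X1 X2 x w).1 +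
  (frame_coord X1 X2 x v).2 * (frame_coord X1 X2 x w).2.

Definition sr_norm (R : realType) (X1 X2 : 'rV[R]_3 -> 'rV[R]_3)
    (x v : 'rV[R]_3) : R :=
  Num.sqrt (sr_metric X1 X2 x v v).

(* The derivative is two-sided, which is harmless at 0 and T since the condition
   is only required almost everywhere. *)
Definition horizontal (R : realType) (X1 X2 : 'rV[R]_3 -> 'rV[R]_3)
    (T : R) (c : R -> 'rV[R]_3) : Prop :=
  [/\ 0 < T, absolutely_continuous 0 T c &
      {ae lebesgue_measure, forall t : R, t \in `[0, T] ->
         derivable c t 1 /\ distribution_span X1 X2 (c t) (derive1 c t)}].

Definition sr_length (R : realType) (X1 X2 : 'rV[R]_3 -> 'rV[R]_3)
    (T : R) (c : R -> 'rV[R]_3) : \bar R :=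
  (\int[lebesgue_measure]_(t in `[0%R, T])
     (sr_norm X1 X2 (c t) (derive1 c t))%:E)%E.

Definition joins (R : realType) (T : R) (c : R -> 'rV[R]_3)
    (x y : 'rV[R]_3) : Prop :=
  c 0 = x /\ c T = y.

Definition sr_distance (R : realType) (X1 X2 : 'rV[R]_3 -> 'rV[R]_3)
    (x y : 'rV[R]_3) : \bar R :=
  ereal_inf [set l | exists T c,
    [/\ horizontal X1 X2 T c, joins T c x y & l = sr_length X1 X2 T c]].

(* c on [0, T] is obtained from c' on [0, S] by a monotone change of parameter,
   which may be constant on subintervals: a horizontal path may pause. *)
Definition reparametrization (R : realType) (T : R) (c : R -> 'rV[R]_3)
    (S : R) (c' : R -> 'rV[R]_3) : Prop :=
  exists phi : R -> R,
    [/\ absolutely_continuous 0 T phi,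
        {in `[0, T] &, {homo phi : s t / s <= t}},
        phi 0 = 0, phi T = S &
        forall t : R, t \in `[0, T] -> c t = c' (phi t)].

(* sigma, on [0, length of c], is the arc length reparametrization of c on
   [0, T]: sigma (s t) = c t, with s t the length of c restricted to [0, t]. *)
Definition arc_length_reparametrization (R : realType)
    (X1 X2 : 'rV[R]_3 -> 'rV[R]_3) (T : R) (c sigma : R -> 'rV[R]_3) : Prop :=
  forall t : R, t \in `[0, T] -> sigma (fine (sr_length X1 X2 t c)) = c t.

Definition P (R : realType) (m : nat) (x : 'rV[R]_3) : R :=
  x 0 0 ^+ 2 - x 0 1 ^+ m.

Definition X1 (R : realType) (x : 'rV[R]_3) : 'rV[R]_3 := vec3 1 0 0.

Definition X2 (R : realType) (m : nat) (x : 'rV[R]_3) : 'rV[R]_3 :=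
  vec3 0 1 (P m x ^+ 2).

Definition gamma_bar (R : realType) (m : nat) (t : R) : 'rV[R]_3 :=
  vec3 (t `^ (m%:R / 2)) t 0.

Arguments X1 {R} x.
Arguments X2 {R} m x.
Arguments gamma_bar {R} m t.

(* Main.v *)
(** A horizontal path projects to a plane curve [(x, y)] of the same Euclidean
    length, subject to the constraint that the integral of [P^2 dy] vanishes.
    The curve [x = y^(m/2)] is calibrated by the unit covector [a dx + b dy]
    which depends on [y] only and is tangent to it: with [d >= 0] the defect
    [speed - a x' - b y'] and [w = x - y^(m/2)],
      length - L = int d - int a'(y) w y'.
    Let [M] be the maximum of [|P|] along the path. When [y' >= 0], Young's
    inequality gives [a'(y) w <= f(y) + P^2 / (12 M^2)] with
    [f(y) = O(M / sqrt (M + |y|))]; when [y' < 0] the defect is at least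
    [|y'| / 2] and absorbs everything. The constraint removes the integral of
    [P^2 y'], so a path not longer than [L] satisfies [int d = O(M)].
    Conversely [(P^3)' = 3 P^2 P'] where [P' = O(eps (d + |y'|))], and the
    constraint again yields [M^3 = O(eps M^2 int d)]. Hence [M = 0] for small
    [eps]; then [d = 0], [y] is monotone and the path runs along the curve.
    The calculus along absolutely continuous paths only uses that such a path
    with almost everywhere nonnegative derivative is nondecreasing.
    Finally the arc length is a smooth function of [t] with smooth inverse, so
    the regularity of the reparametrization is that of [t^(m/2)] at [0]. *)

Require Import Defs.
From HB Require Import structures.
From mathcomp Require Import all_boot all_order all_algebra.
From mathcomp Require Import all_classical all_reals all_analysis.
From mathcomp Require Import measurable_realfun zify ring lra.
Import Order.TTheory GRing.Theory Num.Theory.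
Import numFieldNormedType.Exports.
Local Open Scope classical_set_scope.
Local Open Scope ring_scope.

Set Implicit Arguments.
Unset Strict Implicit.
Unset Printing Implicit Defensive.

(** The obstacle is backward motion: if [y' >= 0] the constraint kills [P^2 y'] at once, but a
    competitor may leave the curve where this shortens it and repair the third coordinate by running
    backward. All estimates are therefore packed into one energy E = 2 (F(y) + s z - S(y) - a w +
    ell), with F' = f, s = 1 / (12 M^2) and S the arc length as a function of height. Its derivative
    is at least the defect d for either sign of y', and its total gain is at most 2 (F(e) - F(0)).
    Each integral estimate becomes the monotonicity of a combination of E with z, y or P^3. The
    shape of f is forced by integrability. With h = y^(m/2), dividing P = w (w + 2 h) by 2 h only
    gives a' w = O(M / y^2). A cubic Young inequality balanced against P^2 leaves M y^(m/2 - 3)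
    instead, at most M / sqrt y because m >= 5. The energy is used twice: with F and s depending on
    M to obtain P = 0, then with F = 0 and s = 0 to identify the path. *)

Local Notation mu := lebesgue_measure.

(** * Absolutely continuous functions *)

(** Covers sums, products, Lipschitz images and coordinates alike: a product needs the increments of
    both factors. When there is a single source, it is passed twice. *)
Lemma ac_dominated (R : realType) (V1 V2 V : normedModType R) (a b K : R)
    (f1 : R -> V1) (f2 : R -> V2) (g : R -> V) :
  absolutely_continuous a b f1 -> absolutely_continuous a b f2 ->
  (forall u v, a <= u -> u <= v -> v <= b ->
     `|g v - g u| <= K * (`|f1 v - f1 u| + `|f2 v - f2 u|)) ->
  absolutely_continuous a b g.
Proof.
move=> ac1 ac2 gle e e0.
have K0 : 0 < 2 * (`|K| + 1) by rewrite mulr_gt0// ltr_wpDl.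
have e'0 : 0 < e / (2 * (`|K| + 1)) by rewrite divr_gt0.
have [d1 d10 h1] := ac1 _ e'0.
have [d2 d20 h2] := ac2 _ e'0.
exists (Num.min d1 d2); first by rewrite lt_min d10.
move=> n I Iab tI; rewrite lt_min => /andP[/(h1 n I Iab tI) s1 /(h2 n I Iab tI) s2].
apply: (@le_lt_trans _ _ ((`|K| + 1) *
    (\sum_(i < n) `|f1 (I i).2 - f1 (I i).1| +
     \sum_(i < n) `|f2 (I i).2 - f2 (I i).1|))).
  rewrite -big_split/= mulr_sumr; apply: ler_sum => i _.
  have [p q r] := Iab i.
  apply: (le_trans (gle _ _ p q r)); rewrite ler_wpM2r ?addr_ge0//.
  by rewrite (le_trans (ler_norm K))// lerDl.
rewrite mulrC -ltr_pdivlMr ?ltr_wpDl//.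
apply: (lt_le_trans (ltrD s1 s2)).
rewrite le_eqVlt; apply/orP; left; apply/eqP; field.
by rewrite lt0r_neq0// ltr_wpDl.
Qed.

Lemma ac_lipschitz (R : realType) (V : normedModType R) (a b K : R)
    (f : R -> V) :
  (forall u v, a <= u -> u <= v -> v <= b -> `|f v - f u| <= K * (v - u)) ->
  absolutely_continuous a b f.
Proof.
move=> fK e e0.
have K0 : 0 < `|K| + 1 by rewrite ltr_wpDl.
exists (e / (`|K| + 1)); first by rewrite divr_gt0.
move=> n I Iab tI; rewrite ltr_pdivlMr// mulrC; apply: le_lt_trans.
rewrite mulr_sumr; apply: ler_sum => i _; have [p q r] := Iab i.
apply: (le_trans (fK _ _ p q r)); rewrite ler_wpM2r ?subr_ge0//.
by rewrite (le_trans (ler_norm K))// lerDl.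
Qed.

Lemma acD (R : realType) (V : normedModType R) (a b : R) (f g : R -> V) :
  absolutely_continuous a b f -> absolutely_continuous a b g ->
  absolutely_continuous a b (fun t => f t + g t).
Proof.
move=> acf acg; apply: (ac_dominated (K := 1) acf acg) => u v _ _ _.
by rewrite mul1r opprD addrACA ler_normD.
Qed.

Lemma acMl (R : realType) (a b k : R) (f : R -> R) :
  absolutely_continuous a b f -> absolutely_continuous a b (fun t => k * f t).
Proof.
move=> acf; apply: (ac_dominated (K := `|k|) acf acf) => u v _ _ _.
by rewrite -mulrBr normrM ler_wpM2l// lerDl.
Qed.

Lemma acM (R : realType) (a b K : R) (f g : R -> R) :
  absolutely_continuous a b f -> absolutely_continuous a b g ->
  (forall t, a <= t -> t <= b -> `|f t| <= K) ->
  (forall t, a <= t -> t <= b -> `|g t| <= K) ->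
  absolutely_continuous a b (fun t => f t * g t).
Proof.
move=> acf acg fK gK; apply: (ac_dominated (K := K) acf acg) => u v au uv vb.
have -> : f v * g v - f u * g u = (f v - f u) * g v + f u * (g v - g u) by ring.
rewrite (le_trans (ler_normD _ _))// !normrM mulrDr lerD//.
  by rewrite mulrC ler_wpM2r// gK// (le_trans au).
by rewrite ler_wpM2r// fK// (le_trans uv).
Qed.

Lemma ac_comp (R : realType) (a b c d K : R) (F f : R -> R) :
  absolutely_continuous a b f ->
  (forall t, a <= t -> t <= b -> c <= f t <= d) ->
  (forall u v, c <= u -> u <= v -> v <= d -> `|F v - F u| <= K * (v - u)) ->
  absolutely_continuous a b (fun t => F (f t)).
Proof.
move=> acf fcd FK; apply: (ac_dominated (K := `|K|) acf acf) => u v au uv vb.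
have /andP[cu ud] := fcd _ au (le_trans uv vb).
have /andP[cv vd] := fcd _ (le_trans au uv) vb.
have FN p q : c <= p -> p <= q -> q <= d -> `|F q - F p| <= `|K| * `|q - p|.
  move=> cp pq qd; apply: (le_trans (FK _ _ cp pq qd)).
  by rewrite (le_trans (ler_norm _))// normrM.
have le2 (p : R) : 0 <= p -> `|K| * p <= `|K| * (p + p).
  by move=> p0; rewrite ler_wpM2l// lerDl.
have [fuv|/ltW fvu] := leP (f u) (f v).
  by apply: le_trans (le2 _ _) => //; exact: FN.
rewrite (distrC (F _)) (distrC (f _)).
by apply: le_trans (le2 _ _) => //; exact: FN.
Qed.

Lemma ac_continuity (R : realType) (V : normedModType R) (a b : R) (f : R -> V) :
  absolutely_continuous a b f -> forall e, 0 < e -> exists2 d, 0 < d &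
    forall u v, a <= u -> u <= v -> v <= b -> v - u < d -> `|f v - f u| < e.
Proof.
move=> acf e e0; have [d d0 h] := acf e e0.
exists d => // u v au uv vb uvd.
have := h 1%N (fun=> (u, v)); rewrite !big_ord1/=; apply => //.
by move=> i j _ _ _; rewrite !ord1.
Qed.

Lemma ac_sub (R : realType) (V : normedModType R) (a b c d : R) (f : R -> V) :
  a <= c -> d <= b -> absolutely_continuous a b f -> absolutely_continuous c d f.
Proof.
move=> ac db acf e e0; have [r r0 h] := acf e e0; exists r => // n I Icd tI sI.
apply: h => // i; have [ci ? id'] := Icd i.
by split => //; [exact: le_trans ci|exact: le_trans db].
Qed.

(** The supremum of the points [x] with [Q a x] is itself reached and, by additivity, can be passed
    unless it is [b]. Around [t] only intervals containing [t] are tested, which is the form in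
    which a derivative at [t] controls increments. *)
Lemma cousin (R : realType) (Q : R -> R -> Prop) (a b : R) : a <= b ->
  (forall u v w, u <= v -> v <= w -> Q u v -> Q v w -> Q u w) ->
  (forall t, a <= t -> t <= b -> exists2 d, 0 < d &
     forall u v, a <= u -> u <= t -> t <= v -> v <= b ->
       t - d < u -> v < t + d -> Q u v) ->
  Q a b.
Proof.
move=> ab Qtrans Qloc.
pose S := [set x | a <= x /\ x <= b /\ Q a x].
have Sa : S a.
  split=> //; split=> //; have [d d0] := Qloc a (lexx a) ab.
  by apply => //; rewrite ?ltrBlDr ltrDl.
have Sb : has_ubound S by exists b => x [_ []].
have hS : has_sup S by split; [exists a|].
pose s := sup S.
have as_ : a <= s by exact: sup_ubound.
have sb : s <= b by apply: ge_sup; [exists a|move=> x [_ []]].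
have [d d0 Qs] := Qloc s as_ sb.
have [x Sx xs] := sup_adherent d0 hS.
have [ax [xb Qax]] := Sx.
have xs' : x <= s by exact: sup_ubound.
pose v := Num.min b (s + d / 2).
have sv : s <= v by rewrite le_min sb lerDl divr_ge0// ltW.
have vb : v <= b by rewrite ge_min lexx.
have vd : v < s + d.
  by rewrite gt_min; apply/orP; right; rewrite ltrD2l ltr_pdivrMr// ltr_pMr// ltr1n.
have Qav : Q a v by apply: (Qtrans _ x) => //; [exact: le_trans sv|exact: Qs].
have : v <= s.
  by apply: sup_ubound => //; split=> //; exact: le_trans sv.
rewrite /v ge_min => /orP[bs|]; last by rewrite gerDl leNgt divr_gt0.
suff <- : v = b by [].
by apply/eqP; rewrite eq_le vb (le_trans bs).
Qed.

Lemma is_derive_increment (R : realType) (f : R -> R) (t l e : R) :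
  is_derive t 1 f l -> 0 < e -> exists2 d, 0 < d &
    forall s, `|s - t| < d -> `|f s - f t - l * (s - t)| <= e * `|s - t|.
Proof.
move=> [df fl] e0.
have /cvgrPdist_le/(_ _ e0) : (h^-1 *: (f (h *: 1 + t) - f t)) @[h --> 0^'] --> l.
  by rewrite -fl; exact: df.
move=> [/= d d0 H]; exists d => // s std.
have [->|st] := eqVneq s t; first by rewrite !subrr mulr0 subrr normr0 mulr0.
have st0 : s - t != 0 by rewrite subr_eq0.
have := H (s - t); rewrite /ball_ /= sub0r normrN => /(_ std st0).
rewrite /GRing.scale/= mulr1 subrK => {}H.
have -> : f s - f t - l * (s - t) = - (l - (s - t)^-1 * (f s - f t)) * (s - t).
  by field.
by rewrite normrM normrN ler_wpM2r.
Qed.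

Lemma ae_imply (R : realType) (P Q : R -> Prop) : (forall t, P t -> Q t) ->
  {ae mu, forall t : R, P t} -> {ae mu, forall t : R, Q t}.
Proof.
move=> PQ [Y [mY Y0 PY]]; exists Y; split => // t nQ.
by apply: PY => /= Pt; exact/nQ/PQ.
Qed.

Lemma ae_and (R : realType) (P Q : R -> Prop) :
  {ae mu, forall t : R, P t} -> {ae mu, forall t : R, Q t} ->
  {ae mu, forall t : R, P t /\ Q t}.
Proof.
have F : Filter (almost_everywhere (@lebesgue_measure R : content _ R)).
  exact: ae_filter_ringOfSetsType.
by move=> P_ Q_; apply: filterI.
Qed.

Lemma ae_open_cover (R : realType) (P : R -> Prop) (d : R) :
  {ae mu, forall t : R, P t} -> 0 < d ->
  exists U : set R, [/\ open U, forall t, ~ P t -> U t & (mu U < d%:E)%E].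
Proof.
move=> [Y [mY Y0 ZY]] d0.
have Yfin : (lebesgue_measure Y < +oo)%E by rewrite (_ : lebesgue_measure Y = 0%E).
have [U [oU YU Ud]] := lebesgue_regularity_outer mY Yfin d0.
exists U; split => //; first by move=> t nPt; apply/YU/ZY.
have mU : measurable U by exact: open_measurable.
have -> : U = (U `\` Y) `|` Y by rewrite setUC setDUK.
rewrite measureU//; [|exact: measurableD|by rewrite setDE -setIA setICl setI0].
suff : (@lebesgue_measure R (U `\` Y) + @lebesgue_measure R Y < d%:E)%E by [].
by rewrite Y0 adde0.
Qed.

Lemma ae_neq (R : realType) (a : R) : {ae mu, forall t : R, t != a}.
Proof.
exists [set a]; split => //; first exact: lebesgue_measure_set1.
by move=> t /= /negP; rewrite negbK => /eqP.
Qed.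

Lemma sum_interval_lengths (R : realType) (n : nat) (I : 'I_n -> R * R)
    (U : set R) (d : R) :
  (forall i, (I i).1 <= (I i).2) ->
  trivIset [set: 'I_n] (fun i => `](I i).1, (I i).2[%classic) ->
  (forall i, `](I i).1, (I i).2[ `<=` U) -> measurable U ->
  (mu U < d%:E)%E ->
  \sum_(i < n) ((I i).2 - (I i).1) < d.
Proof.
move=> Ile tI IU mU; rewrite -lte_fin; apply: le_lt_trans.
rewrite -sumEFin.
have -> : (\sum_(i < n) ((I i).2 - (I i).1)%:E =
    \sum_(i < n) mu (`](I i).1, (I i).2[%classic : set R))%E.
  apply: eq_bigr => i _; rewrite lebesgue_measure_itv/= lte_fin.
  case: ifPn => [_|]; first by rewrite EFinB.
  rewrite -leNgt => Ige; congr EFin.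
  by apply/eqP; rewrite subr_eq0 eq_le Ige Ile.
rewrite -(measure_bigsetU_ord _ predT)//.
apply: le_measure; rewrite ?inE//; first exact: bigsetU_measurable.
by rewrite -bigcup_seq => x /= [i _]; exact: IU.
Qed.

(* Cousin's lemma splits [a, b] into short intervals: around a point where the
   derivative exists the increment is almost nonnegative, and the remaining
   intervals lie in an open set so small that A barely varies on them. *)
Lemma ac_le_endpoints (R : realType) (a b : R) (A N : R -> R) : a <= b ->
  absolutely_continuous a b A ->
  (forall u v, a <= u -> u <= v -> v <= b -> N u <= N v) ->
  {ae mu, forall t, a < t -> t < b ->
     exists2 l, 0 <= l & is_derive t 1 (fun s => A s + N s) l} ->
  A a + N a <= A b + N b.
Proof.
move=> ab acA ndN dAN.
pose G s := A s + N s.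
suff H e : 0 < e -> G a - G b <= e * (b - a) + e.
  rewrite -subr_le0; apply/ler_addgt0Pr => e e0; rewrite add0r.
  have k0 : 0 < b - a + 1 by rewrite ltr_wpDl// subr_ge0.
  apply: (le_trans (H (e / (b - a + 1)) _)); first by rewrite divr_gt0.
  by rewrite -[X in _ + X]mulr1 -mulrDr divfK// lt0r_neq0.
move=> e0; have [d d0 acd] := acA e e0.
pose good t := a < t /\ t < b /\
  exists2 l, 0 <= l & is_derive t 1 (fun s => A s + N s) l.
have aegood : {ae mu, forall t, a <= t -> t <= b -> good t}.
  apply: ae_imply (ae_and (ae_and (ae_neq a) (ae_neq b)) dAN) => t [[ta tb] h]; rewrite le_eqVlt eq_sym (negPf ta) => at_.
  by rewrite le_eqVlt (negPf tb) => tb'; do 2!split => //; exact: h.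
have [U [oU ZU Ud]] := ae_open_cover aegood d0.
(* The list holds the intervals around bad points, ordered from left to right so that the lists of
   adjacent intervals concatenate. Good intervals cost [e] per unit length; on bad ones only the
   variation of [A] is charged, since [N] cannot decrease. *)
pose Q u v := exists l : seq (R * R), [/\
  all (fun I => [&& u <= I.1, I.1 <= I.2 & I.2 <= v]) l,
  pairwise (fun I J : R * R => I.2 <= J.1) l,
  (forall I, I \in l -> `]I.1, I.2[ `<=` U) &
  G u - G v <= e * (v - u) + \sum_(I <- l) `|A I.2 - A I.1| ].
have : Q a b.
  apply: cousin => //.
    move=> u v w uv vw [l1 [l1in l1p l1U l1s]] [l2 [l2in l2p l2U l2s]].
    exists (l1 ++ l2); split.
    - rewrite all_cat; apply/andP; split.
        apply: sub_all l1in => I /and3P[-> ->] /le_trans ->//.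
      by apply: sub_all l2in => I /and3P[/(le_trans uv) -> -> ->].
    - rewrite pairwise_cat l1p l2p !andbT.
      apply/allrelP => I J /(allP l1in)/and3P[_ _ h1] /(allP l2in)/and3P[h2 _ _].
      exact: le_trans h2.
    - by move=> I; rewrite mem_cat => /orP[/l1U|/l2U].
    - rewrite big_cat/=.
      have -> : G u - G w = (G u - G v) + (G v - G w) by ring.
      apply: (le_trans (lerD l1s l2s)).
      by rewrite le_eqVlt; apply/orP; left; apply/eqP; ring.
  move=> t at_ tb; have [[_ [_ [l l0 /is_derive_increment dl]]]|ngt] := pselect (good t).
    have [r r0 H] := dl _ e0; exists r => // u v au ut tv vb tu vt.
    exists [::]; split => //; rewrite big_nil addr0.
    have := H u; rewrite distrC ger0_norm ?subr_ge0//; rewrite ltrBlDr -ltrBlDl => /(_ tu).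
    have := H v; rewrite [`|v - t|]ger0_norm ?subr_ge0// ltrBlDl => /(_ vt).
    rewrite -/(G u) -/(G t) -/(G v) !ler_norml => /andP[hv _] /andP[_ hu].
    have h1 : 0 <= l * (v - t) by rewrite mulr_ge0// subr_ge0.
    have h2 : 0 <= l * (t - u) by rewrite mulr_ge0// subr_ge0.
    lra.
  have Ut : U t by apply: ZU => h; exact/ngt/h.
  have /nbhs_ballP[r /= r0 rU] : nbhs t U by exact: open_nbhs_nbhs.
  exists r => // u v au ut tv vb tu vt; exists [:: (u, v)]; split => //=.
  - by rewrite !lexx (le_trans ut tv).
  - move=> I; rewrite inE => /eqP -> x /=; rewrite in_itv/= => /andP[ux xv].
    apply: rU; rewrite /ball/= ltr_norml; apply/andP; split; lra.
  - rewrite big_seq1/= /G.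
    have uv := le_trans ut tv.
    have h1 := ndN _ _ au uv vb.
    have h2 : 0 <= e * (v - u) by rewrite mulr_ge0 ?subr_ge0// ltW.
    have := ler_norm (- (A v - A u)); rewrite normrN => h3.
    lra.
move=> [l [lin lp lU ls]].
apply: (le_trans ls); rewrite lerD2l.
pose I (i : 'I_(size l)) := nth (0, 0) l i.
have Iin i : I i \in l by exact: mem_nth.
have sumE (F : R * R -> R) : \sum_(J <- l) F J = \sum_(i < size l) F (I i).
  by rewrite (big_nth (0, 0)) big_mkord.
have tI : trivIset [set: 'I_(size l)] (fun i => `](I i).1, (I i).2[%classic).
  have lt (i j : 'I_(size l)) : (i < j)%N -> (I i).2 <= (I j).1.
    by move=> ij; move/(pairwiseP (0, 0)) : lp; apply => //; exact: ltn_ord.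
  move=> i j _ _ [x /= []]; rewrite !in_itv/= => /andP[ix xi] /andP[jx xj].
  apply: ord_inj; case: (ltngtP (nat_of_ord i) (nat_of_ord j)) => // /lt h.
    by have := lt_le_trans xi h; move=> /lt_trans/(_ jx); rewrite ltxx.
  by have := lt_le_trans xj h; move=> /lt_trans/(_ ix); rewrite ltxx.
rewrite sumE ltW//; apply: acd => //.
  by move=> i; have /(allP lin)/and3P[] := Iin i.
apply: (@sum_interval_lengths _ _ _ U) => //.
- by move=> i; have /(allP lin)/and3P[] := Iin i.
- by move=> i; exact: lU.
- exact: open_measurable.
Qed.

(** The summand [N] receives the multiple of the arc length [ell], of which only the monotonicity
    and the almost everywhere derivative are recorded. *)
Lemma ac_nondecreasing (R : realType) (a b : R) (A N : R -> R) :
  absolutely_continuous a b A ->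
  (forall u v, a <= u -> u <= v -> v <= b -> N u <= N v) ->
  {ae mu, forall t, a < t -> t < b ->
     exists2 l, 0 <= l & is_derive t 1 (fun s => A s + N s) l} ->
  forall u v, a <= u -> u <= v -> v <= b -> A u + N u <= A v + N v.
Proof.
move=> acA ndN dAN u v au uv vb; apply: ac_le_endpoints => //.
- exact: ac_sub acA.
- by move=> p q up pq qv; apply: ndN => //; [exact: le_trans up|exact: le_trans vb].
- apply: ae_imply dAN => t h ut tv; apply: h.
    exact: le_lt_trans ut.
  exact: lt_le_trans vb.
Qed.

(** * Arc length of a horizontal path *)

Lemma vec3_0 (R : realType) (a b c : R) : vec3 a b c 0 0 = a.
Proof. by rewrite mxE. Qed.

Lemma vec3_1 (R : realType) (a b c : R) : vec3 a b c 0 1 = b.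
Proof. by rewrite mxE. Qed.

Lemma vec3_2 (R : realType) (a b c : R) : vec3 a b c 0 ord_max = c.
Proof. by rewrite mxE. Qed.

Lemma row3P (R : realType) (v w : 'rV[R]_3) :
  v 0 0 = w 0 0 -> v 0 1 = w 0 1 -> v 0 ord_max = w 0 ord_max -> v = w.
Proof.
move=> h0 h1 h2; apply/rowP => -[[|[|[|//]]] i3].
- by rewrite (_ : Ordinal i3 = 0) //; exact: val_inj.
- by rewrite (_ : Ordinal i3 = 1) //; exact: val_inj.
- by rewrite (_ : Ordinal i3 = ord_max) //; exact: val_inj.
Qed.

(** The first two components of the frame fields form the standard basis of the plane at every
    point, so the set under [xget] is a singleton. *)
Lemma frame_coordE (R : realType) (m : nat) (x : 'rV[R]_3) (u : R * R) :
  frame_coord X1 (X2 m) x (u.1 *: X1 x + u.2 *: X2 m x) = u.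
Proof.
rewrite /frame_coord; case: xgetP => [w _ /= E|/(_ u)/=]; last by [].
have := congr1 (fun v : 'rV[R]_3 => v 0 0) E.
have := congr1 (fun v : 'rV[R]_3 => v 0 1) E.
rewrite /X1 /X2 !mxE/= !(mulr0, mulr1, addr0, add0r) => e2 e1.
by rewrite [u]surjective_pairing [w]surjective_pairing e1 e2.
Qed.

Lemma sr_normE (R : realType) (m : nat) (x : 'rV[R]_3) (u : R * R) :
  sr_norm X1 (X2 m) x (u.1 *: X1 x + u.2 *: X2 m x) =
  Num.sqrt (u.1 ^+ 2 + u.2 ^+ 2).
Proof. by rewrite /sr_norm /sr_metric frame_coordE -!expr2. Qed.

Lemma is_derive_coord (R : realType) (c : R -> 'rV[R]_3) (t : R) (i : 'I_3) :
  derivable c t 1 -> is_derive t 1 (fun s => c s 0 i) (derive1 c t 0 i).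
Proof.
move=> dc; split; first by have /derivable_mxP := dc; exact.
by rewrite derive1E derive_mx// mxE.
Qed.

(** Both sides are suprema over the simple functions below the integrand, and these are monotone
    even for nonmeasurable integrands. This matters for the speed, which is arbitrary on a null
    set. *)
Lemma le_integral_ge0 (R : realType) (D : set R) (f g : R -> \bar R) :
  (forall x, D x -> (0 <= f x)%E) -> (forall x, D x -> (f x <= g x)%E) ->
  (\int[mu]_(x in D) f x <= \int[mu]_(x in D) g x)%E.
Proof.
move=> f0 fg; rewrite !ge0_integralE//; last first.
  by move=> x Dx; rewrite (le_trans (f0 x Dx))// fg.
apply: le_ereal_sup => _ [h /= hf <-]; exists h => // x.
by apply: (le_trans (hf x)); apply: lee_restrict.
Qed.

(** Clamping the argument replaces the arbitrary values outside [[0, T]] by the endpoint values, so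
    that the difference quotients in [measurable_derivative] are continuous on the whole line. *)
Lemma clamp_continuous (R : realType) (T : R) (f : R -> R) : 0 < T ->
  absolutely_continuous 0 T f ->
  continuous (fun t => f (Num.max 0 (Num.min T t))).
Proof.
move=> T0 acf t; apply/cvgrPdist_lt => e e0.
have [d d0 H] := ac_continuity acf e0.
have clampP (s : R) : 0 <= Num.max 0 (Num.min T s) <= T.
  by rewrite le_max lexx /= ge_max ltW//= ge_min lexx.
near=> s.
have st : `|t - s| < d by near: s; exact: cvgr_dist_lt.
have H' (p q : R) : p <= q -> q - p < d ->
    `|f (Num.max 0 (Num.min T q)) - f (Num.max 0 (Num.min T p))| < e.
  move=> pq qpd; apply: H; do ?by have /andP[] := clampP p.
  - by rewrite ge_max le_max lexx/= le_max le_min !ge_min lexx/= pq !orbT.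
  - by have /andP[] := clampP q.
  - apply: le_lt_trans qpd; rewrite /Num.max /Num.min.
    by do ![case: ifPn]; rewrite -?leNgt; lra.
have [ts|/ltW ts] := leP t s.
  by rewrite distrC H'//; apply: le_lt_trans st; rewrite distrC ler_norm.
by rewrite H'//; apply: le_lt_trans st; rewrite ler_norm.
Unshelve. all: by end_near. Qed.

Lemma difference_quotient_cvg (R : realType) (T : R) (f : R -> R) (t l : R) :
  0 < t -> t < T -> is_derive t 1 f l ->
  (fun n => n.+1%:R * (f (Num.max 0 (Num.min T (t + n.+1%:R^-1))) -
                       f (Num.max 0 (Num.min T t)))) @ \oo --> l.
Proof.
move=> t0 tT /is_derive_increment dl; apply/cvgrPdist_le => e e0.
have [d d0 H] := dl _ e0.
have Tt0 : 0 < T - t by rewrite subr_gt0.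
near=> n.
have n0 : 0 < n.+1%:R^-1 :> R by rewrite invr_gt0.
have nd : n.+1%:R^-1 < d by near: n; exact: (near_infty_natSinv_lt (PosNum d0)).
have nT : n.+1%:R^-1 < T - t.
  by near: n; exact: (near_infty_natSinv_lt (PosNum Tt0)).
have cl s : 0 < s -> s < T -> Num.max 0 (Num.min T s) = s.
  by move=> s0 sT; rewrite min_r ?ltW// max_r// ltW.
rewrite !cl//; [|by rewrite addr_gt0|by rewrite addrC -ltrBrDr].
have := H (t + n.+1%:R^-1); rewrite addrAC subrr add0r gtr0_norm// => /(_ nd) {}H.
set h := n.+1%:R^-1 in n0 nd nT H *.
have Nh : n.+1%:R * h = 1 by rewrite mulfV// pnatr_eq0.
rewrite (_ : l - _ = n.+1%:R * - (f (t + h) - f t - l * h)); last first.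
  by rewrite mulrN !mulrBr [_ * (l * h)]mulrCA Nh mulr1 [in RHS]opprB.
rewrite normrM normrN ger0_norm ?ler0n//.
have -> : e = n.+1%:R * (e * h) by rewrite mulrCA Nh mulr1.
by rewrite ler_wpM2l ?ler0n.
Unshelve. all: by end_near. Qed.

Lemma measurable_derivative (R : realType) (T : R) (f f' : R -> R) (D : set R) :
  0 < T -> absolutely_continuous 0 T f -> measurable D ->
  (forall t, D t -> [/\ 0 < t, t < T & is_derive t 1 f (f' t)]) ->
  measurable_fun D f'.
Proof.
move=> T0 acf mD Df.
pose cl (s : R) := Num.max 0 (Num.min T s).
refine (@measurable_fun_cvg _ _ _ _ (fun n (t : R) => n.+1%:R *
  (f (cl (t + n.+1%:R^-1)) - f (cl t))) _ _ _); last first.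
  by move=> t /Df[t0 tT dft]; exact: difference_quotient_cvg.
move=> n; apply: measurable_funTS; apply: continuous_measurable_fun.
have cf := clamp_continuous T0 acf.
move=> t; apply: cvgM; first exact: cvg_cst.
apply: cvgB; last exact: cf.
have shift : s + n.+1%:R^-1 @[s --> t] --> t + n.+1%:R^-1.
  by apply: cvgD; [exact: cvg_id|exact: cvg_cst].
exact: (cvg_comp _ _ shift (cf _)).
Qed.

Lemma coord_norm_le (R : realType) (v : 'rV[R]_3) (i : 'I_3) : `|v 0 i| <= `|v|.
Proof.
rewrite [leRHS]/Num.Def.normr/= mx_normrE.
exact: (le_bigmax _ (fun k => `|v k.1 k.2|) (0, i)).
Qed.

Lemma ac_coord (R : realType) (T : R) (c : R -> 'rV[R]_3) (i : 'I_3) :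
  absolutely_continuous 0 T c -> absolutely_continuous 0 T (fun s => c s 0 i).
Proof.
move=> acc; apply: (ac_dominated (K := 1) acc acc) => u v _ _ _.
rewrite mul1r (le_trans _ (_ : `|c v - c u| <= _)) ?lerDl//.
have -> : c v 0 i - c u 0 i = (c v - c u) 0 i by rewrite !mxE.
exact: coord_norm_le.
Qed.

(* The speed need not be Borel measurable; it is so on a set of full measure,
   which suffices to bound the integral from below. *)
Lemma arc_length_function (R : realType) (m : nat) (T : R) (c : R -> 'rV[R]_3) :
  horizontal X1 (X2 m) T c -> (sr_length X1 (X2 m) T c < +oo)%E ->
  exists ell : R -> R, [/\ ell 0 = 0,
    forall u v, u <= v -> ell u <= ell v,
    ((ell T)%:E <= sr_length X1 (X2 m) T c)%E &
    {ae mu, forall t, 0 < t -> t < T -> exists u1 u2 : R,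
      [/\ is_derive t 1 (fun s => c s 0 0) u1,
          is_derive t 1 (fun s => c s 0 1) u2,
          is_derive t 1 (fun s => c s 0 ord_max) (P m (c t) ^+ 2 * u2) &
          is_derive t 1 ell (Num.sqrt (u1 ^+ 2 + u2 ^+ 2))]}].
Proof.
move=> [T0 acc dc] lenfin.
pose spd t := sr_norm X1 (X2 m) (c t) (derive1 c t).
have spd0 t : 0 <= spd t by rewrite sqrtr_ge0.
have acci (i : 'I_3) : absolutely_continuous 0 T (fun s => c s 0 i).
  exact: ac_coord.
have [Y [mY Y0 YP]] := dc.
pose D := `]0, T[ `\` Y.
have mD : measurable D by exact: measurableD.
have DP t : D t -> [/\ 0 < t, t < T, derivable c t 1 &
    derive1 c t = derive1 c t 0 0 *: X1 (c t) + derive1 c t 0 1 *: X2 m (c t)].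
  move=> [/=]; rewrite in_itv/= => /andP[t0 tT] nYt.
  have : t \in `[0, T] -> derivable c t 1 /\
      distribution_span X1 (X2 m) (c t) (derive1 c t).
    by apply: contrapT => /YP.
  rewrite in_itv/= !ltW// => /(_ isT)[dct [u uE]]; split => //.
  by rewrite {1}uE [in RHS]uE /X1 /X2 !mxE/= !(mulr0, mulr1, addr0, add0r).
have spdE t : D t ->
    spd t = Num.sqrt (derive1 c t 0 0 ^+ 2 + derive1 c t 0 1 ^+ 2).
  move=> /DP[_ _ _ E]; rewrite /spd {1}E.
  exact: (sr_normE m (c t) (derive1 c t 0 0, derive1 c t 0 1)).
have mder (i : 'I_3) : measurable_fun D (fun t => derive1 c t 0 i).
  apply: (measurable_derivative T0 (acci i) mD) => t /DP[t0 tT dct _].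
  by split => //; exact: is_derive_coord.
have mspd : measurable_fun D spd.
  apply: (eq_measurable_fun (fun t =>
      Num.sqrt (derive1 c t 0 0 ^+ 2 + derive1 c t 0 1 ^+ 2))).
    by move=> t; rewrite inE => /spdE.
  apply: measurableT_comp; first exact: continuous_measurable_fun (@sqrt_continuous R).
  by apply: measurable_funD; exact: measurable_funX.
(* Setting the speed to 0 off [D] makes it Borel. The primitive of [g] is then known to be at most
   the length, which is the direction that a lower bound on lengths needs. *)
pose g := spd \_ D.
have g0 t : 0 <= g t by rewrite /g patchE; case: ifP.
have mg : measurable_fun setT g by apply/(measurable_restrictT _ _).1.
have gT : (\int[mu]_(t in `[0%R, T]) (g t)%:E <= sr_length X1 (X2 m) T c)%E.
  apply: le_integral_ge0 => t _; rewrite lee_fin// /g patchE.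
  by case: ifP => // _; exact: spd0.
have intg : mu.-integrable setT (EFin \o g).
  apply/integrableP; split; first exact/measurable_EFinP.
  under eq_integral do rewrite /= ger0_norm//.
  apply: le_lt_trans lenfin; apply: le_trans gT.
  rewrite [leRHS]integral_mkcond; apply: le_integral_ge0 => t _.
    by rewrite lee_fin.
  rewrite patchE; case: ifPn => //; rewrite notin_setE/= => nt.
  rewrite lee_fin /g patchE; case: ifPn => //; rewrite inE => /DP[t0 tT _ _].
  by exfalso; apply: nt; rewrite in_itv/= !ltW.
have intS (y : R) : mu.-integrable `[0, y] (EFin \o g).
  by apply: integrableS intg.
pose ell y := (\int[mu]_(t in `[0, y]) g t)%R.
exists ell; split.
- by rewrite /ell set_itv1 Rintegral_set1.
- move=> u v uv; rewrite /ell /Rintegral fine_le//.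
  + by apply: integrable_fin_num (intS u).
  + by apply: integrable_fin_num (intS v).
  + apply: ge0_subset_integral => //.
    * by apply: measurable_funTS; exact/measurable_EFinP.
    * by move=> t _; rewrite lee_fin.
    * by apply: subset_itvl; rewrite bnd_simp.
- rewrite /ell /Rintegral fineK//; exact: integrable_fin_num (intS T).
have locg : locally_integrable [set: R] g.
  suff -> : g = g \_ setT by exact: integrable_locally.
  by rewrite patch_setT.
have aell := FTC1 intS locg.
have aD : {ae mu, forall t, ~ Y t}.
  by exists Y; split => // t /= /contrapT.
apply: ae_imply (ae_and aell aD) => t [dell nYt] t0 tT.
have Dt : D t by split => //=; rewrite in_itv/= t0.
have [_ _ dct E] := DP _ Dt.
exists (derive1 c t 0 0), (derive1 c t 0 1); split.
- exact: is_derive_coord.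
- exact: is_derive_coord.
- have -> : P m (c t) ^+ 2 * derive1 c t 0 1 = derive1 c t 0 ord_max.
    by rewrite [in RHS]E !mxE/= mulr0 add0r mulrC.
  exact: is_derive_coord.
have [] := dell; first by have := ltW t0.
rewrite derive1E => de1 de2; split => //.
by rewrite de2 /g patchE mem_set// spdE.
Qed.

(** * Calibration of the curve *)

Section derivation_rules.
Context {R : realType}.
Implicit Types (f g : R -> R) (x a b : R).

Lemma deriv_add f g x a b : is_derive x 1 f a -> is_derive x 1 g b ->
  is_derive x 1 (fun t => f t + g t) (a + b).
Proof. exact: is_deriveD. Qed.

Lemma deriv_sub f g x a b : is_derive x 1 f a -> is_derive x 1 g b ->
  is_derive x 1 (fun t => f t - g t) (a - b).
Proof. exact: is_deriveB. Qed.

Lemma deriv_scale (k : R) f x a : is_derive x 1 f a ->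
  is_derive x 1 (fun t => k * f t) (k * a).
Proof. exact: is_deriveZ. Qed.

Lemma deriv_mul f g x a b : is_derive x 1 f a -> is_derive x 1 g b ->
  is_derive x 1 (fun t => f t * g t) (a * g x + f x * b).
Proof.
move=> fa gb; apply: is_derive_eq (is_deriveM fa gb) _.
by rewrite /GRing.scale/= addrC; congr (_ + _); exact: mulrC.
Qed.

Lemma deriv_pow f x a n : is_derive x 1 f a ->
  is_derive x 1 (fun t => f t ^+ n) (n%:R * f x ^+ n.-1 * a).
Proof.
move=> fa; have -> : (fun t => f t ^+ n) = f ^+ n.
  by apply/funext => t; rewrite exprfctE.
exact: is_deriveX.
Qed.

Lemma deriv_comp f g x a b : is_derive (g x) 1 f a -> is_derive x 1 g b ->
  is_derive x 1 (fun t => f (g t)) (a * b).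
Proof. exact: is_derive1_comp. Qed.

Lemma deriv_continuous f a x : is_derive x 1 f a -> {for x, continuous f}.
Proof. by case=> df _; exact/differentiable_continuous/derivable1_diffP. Qed.

Lemma deriv_increment_bound f (f' : R -> R) (u v c K : R) : u <= v ->
  (forall x, u <= x -> x <= v -> is_derive x 1 f (f' x)) ->
  (forall x, u <= x -> x <= v -> `|f' x - c| <= K) ->
  `|f v - f u - c * (v - u)| <= K * (v - u).
Proof.
rewrite le_eqVlt => /predU1P[->|uv] df fK.
  by rewrite !subrr !mulr0 subrr normr0.
have [z zuv ->] : exists2 z, z \in `]u, v[ & f v - f u = f' z * (v - u).
  apply: MVT => //.
    by move=> x; rewrite in_itv/= => /andP[ux xv]; apply: df; exact: ltW.
  apply/continuous_in_subspaceT => x; rewrite inE/= in_itv/= => /andP[ux xv].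
  exact: deriv_continuous (df _ ux xv).
move: zuv; rewrite in_itv/= => /andP[/ltW uz /ltW zv].
have vu0 : 0 <= v - u by rewrite subr_ge0 ltW.
by rewrite -mulrBl normrM (ger0_norm vu0) ler_wpM2r// fK.
Qed.

(** Integrating from [- r] rather than from 0 makes 0 an interior point, with a two-sided
    derivative: competitors may visit heights [y < 0]. *)
Lemma antiderivative f (r : R) : 0 < r -> continuous f ->
  exists2 F : R -> R, F 0 = 0 &
    forall x, - r < x -> x < r -> is_derive x 1 F (f x).
Proof.
move=> r0 cf.
pose G y := (\int[mu]_(t in `[- r, y]) f t)%R.
exists (fun y => G y - G 0); first by rewrite subrr.
move=> x rx xr; rewrite -[f x]subr0.
apply: deriv_sub.
have intf : mu.-integrable `[- r, r] (EFin \o f).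
  by apply: continuous_compact_integrable; [exact: segment_compact|exact: continuous_subspaceT].
have [dG GE] := continuous_FTC1_closed xr intf rx (cf x).
split; first exact: dG.
by rewrite -derive1E GE.
Qed.

End derivation_rules.

(* The power [y `^ (n + 1/2)] for [y >= 0], extended by [0] to [y < 0]. *)
Definition half_pow (R : realType) (n : nat) (y : R) : R := y ^+ n * Num.sqrt y.

Section half_pow_theory.
Context {R : realType}.
Implicit Types (y : R) (n : nat).

Lemma half_pow_continuous n : continuous (@half_pow R n).
Proof. by move=> y; apply: cvgM; [exact: exprn_continuous|exact: sqrt_continuous]. Qed.

Lemma half_pow_le0 n y : y <= 0 -> half_pow n y = 0.
Proof. by move=> y0; rewrite /half_pow ler0_sqrtr// mulr0. Qed.

Lemma half_pow_ge0 n y : 0 <= half_pow n y.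
Proof.
have [y0|y0] := leP 0 y; first by rewrite mulr_ge0 ?exprn_ge0 ?sqrtr_ge0.
by rewrite half_pow_le0// ltW.
Qed.

Lemma half_powS n y : half_pow n.+1 y = y * half_pow n y.
Proof. by rewrite /half_pow exprS mulrA. Qed.

Lemma half_pow_sqr n y : 0 <= y -> half_pow n y ^+ 2 = y ^+ n.*2.+1.
Proof.
by move=> y0; rewrite exprMn sqr_sqrtr// -exprM muln2 exprSr.
Qed.

Lemma half_pow_norm_le n y : `|y| <= 1 -> half_pow n.+1 y <= `|y|.
Proof.
have [y0 y1|y0 _] := leP 0 y; last by rewrite half_pow_le0// ltW.
move: y1; rewrite ger0_norm// => y1; rewrite half_powS ler_piMr//.
rewrite mulr_ile1 ?exprn_ge0 ?sqrtr_ge0 ?exprn_ile1//.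
by rewrite -[leRHS]sqrtr1 ler_sqrt.
Qed.

Lemma half_pow_le_sqrt n y : y <= 1 -> half_pow n y <= Num.sqrt y.
Proof.
move=> y1; have [y0|y0] := leP 0 y; last by rewrite half_pow_le0 ?sqrtr_ge0// ltW.
by rewrite ler_piMl ?sqrtr_ge0// exprn_ile1.
Qed.

(** At 0 the difference quotient of [half_pow n.+1] is [half_pow n] itself, which is continuous and
    zero there. *)
Lemma half_pow_derive n y :
  is_derive y 1 (@half_pow R n.+1) ((n.+1%:R + 2^-1) * half_pow n y).
Proof.
case: (ltgtP y 0) => [y0|y0|->].
- rewrite (half_pow_le0 n (ltW y0)) mulr0.
  apply: (@near_eq_is_derive _ _ _ (cst 0)).
  near=> z; rewrite half_pow_le0//; apply/ltW.
  by near: z; exact: lt_nbhsl.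
- apply: is_derive_eq (deriv_mul (deriv_pow n.+1 (is_derive_id y 1)) (is_derive1_sqrt y0)) _.
  rewrite /half_pow/= mulr1 invfM exprS.
  have s0 : Num.sqrt y != 0 by rewrite gt_eqF// sqrtr_gt0.
  rewrite -{3}(sqr_sqrtr (ltW y0)).
  by field.
- rewrite half_pow_le0// mulr0.
  have cv : (h^-1 *: (half_pow n.+1 (h *: 1 + 0) - half_pow n.+1 0)) @[h --> (0:R)^'] --> (0:R).
    have E : {near (0:R)^', half_pow n =1
        (fun h => h^-1 *: (half_pow n.+1 (h *: 1 + 0) - half_pow n.+1 0))}.
      near=> h; have h0 : h != 0 by near: h; exact: nbhs_dnbhs_neq.
      rewrite /GRing.scale/= mulr1 addr0 [half_pow n.+1 0]half_pow_le0// subr0.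
      by rewrite half_powS mulKf.
    apply: cvg_trans (near_eq_cvg E) _.
    have := @half_pow_continuous n 0; rewrite /continuous_at half_pow_le0//.
    exact: cvg_within_filter.
  split; first by apply/cvg_ex; exists 0.
  exact: cvg_lim cv.
Unshelve. all: by end_near. Qed.

End half_pow_theory.

Section calibration.
Context {R : realType} (k : nat).
Implicit Types (y : R).

(* The exponent [m / 2]: here and below [m = 2 (k + 2) + 1]. *)
Definition mbar : R := k.+2%:R + 2^-1.

(** This is mbar (mbar - 1), the coefficient of the second derivative of y^(m/2). *)
Definition calib_const : R := mbar * (k.+1%:R + 2^-1).

(** The derivative of the reference graph x = y^(m/2). It vanishes for [y <= 0]: the graph is
    prolonged by the half-axis x = 0, where the calibrating covector is dy. *)
Definition slope y := mbar * half_pow k.+1 y.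

Definition arc_speed y := Num.sqrt (1 + slope y ^+ 2).

Definition calib1 y := slope y / arc_speed y.

Definition calib2 y := (arc_speed y)^-1.

(** The curvature h'' / (1 + h'^2)^(3/2) of the graph x = h(y), with h = [half_pow k.+2]. *)
Definition dcalib1 y := calib_const * half_pow k y / arc_speed y ^+ 3.

Lemma mbar_gt0 : 0 < mbar. Proof. by rewrite ltr_wpDl. Qed.

Lemma calib_const_ge3 : 3 <= calib_const.
Proof.
have k0 : 0 <= k%:R :> R by [].
rewrite /calib_const /mbar -!(natr1 k) -!(natr1 k.+1) -(natr1 k); nra.
Qed.

Lemma slope_ge0 y : 0 <= slope y.
Proof. by rewrite mulr_ge0 ?(ltW mbar_gt0)// half_pow_ge0. Qed.

Lemma arc_speed_sqr y : arc_speed y ^+ 2 = 1 + slope y ^+ 2.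
Proof. by rewrite sqr_sqrtr// addr_ge0// sqr_ge0. Qed.

Lemma arc_speed_ge1 y : 1 <= arc_speed y.
Proof. by rewrite -[X in X <= _]sqrtr1 ler_sqrt// ?lerDl ?sqr_ge0// addr_ge0// sqr_ge0. Qed.

Lemma arc_speed_gt0 y : 0 < arc_speed y.
Proof. exact: lt_le_trans ltr01 (arc_speed_ge1 y). Qed.

Lemma slope_continuous : continuous slope.
Proof. by move=> y; apply: cvgM; [exact: cvg_cst|exact: half_pow_continuous]. Qed.

Lemma arc_speed_continuous : continuous arc_speed.
Proof.
move=> y; have cs : 1 + slope z ^+ 2 @[z --> y] --> 1 + slope y ^+ 2.
  apply: cvgD; first exact: cvg_cst.
  by rewrite expr2; apply: cvgM; exact: slope_continuous.
exact: (cvg_comp _ _ cs (@sqrt_continuous R _)).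
Qed.

Lemma slope_derive y : is_derive y 1 slope (calib_const * half_pow k y).
Proof.
rewrite /calib_const -mulrA; exact: deriv_scale (half_pow_derive k y).
Qed.

Lemma height_derive y : is_derive y 1 (@half_pow R k.+2) (slope y).
Proof. exact: half_pow_derive. Qed.

Lemma arc_speed_derive y :
  is_derive y 1 arc_speed (slope y * (calib_const * half_pow k y) / arc_speed y).
Proof.
have s0 : 0 < 1 + slope y ^+ 2 by rewrite ltr_wpDr// sqr_ge0.
have dr : is_derive y 1 (fun z => 1 + slope z ^+ 2)
    (0 + 2%:R * slope y ^+ 2.-1 * (calib_const * half_pow k y)).
  exact: deriv_add (deriv_pow 2 (slope_derive y)).
have := @deriv_comp _ Num.sqrt (fun z => 1 + slope z ^+ 2) _ _ _
  (is_derive1_sqrt s0) dr.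
rewrite -/(arc_speed y) -/arc_speed; move/is_derive_eq; apply.
rewrite /= expr1 add0r invfM.
by field; rewrite gt_eqF// arc_speed_gt0.
Qed.

Lemma calib1_derive y : is_derive y 1 calib1 (dcalib1 y).
Proof.
have s0 : arc_speed y != 0 by rewrite gt_eqF// arc_speed_gt0.
apply: is_derive_eq (deriv_mul (slope_derive y) (is_deriveV s0 (arc_speed_derive y))) _.
rewrite /dcalib1 /GRing.scale/=.
have E : calib_const * half_pow k y =
    calib_const * half_pow k y * (arc_speed y ^+ 2 - slope y ^+ 2).
  by rewrite arc_speed_sqr addrK mulr1.
rewrite [in RHS]E; field.
exact: s0.
Qed.

Lemma calib_unit y : calib1 y ^+ 2 + calib2 y ^+ 2 = 1.
Proof.
have s0 : arc_speed y != 0 by rewrite gt_eqF// arc_speed_gt0.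
rewrite /calib1 /calib2 exprMn exprVn -[X in _ + X]mul1r -mulrDl addrC.
by rewrite -arc_speed_sqr mulfV// expf_neq0.
Qed.

(** Equality in Cauchy-Schwarz: the unit covector is aligned with the tangent (slope, 1), so the
    defect vanishes along the curve. *)
Lemma calib1_slope y : calib1 y * slope y + calib2 y = arc_speed y.
Proof.
have s0 : arc_speed y != 0 by rewrite gt_eqF// arc_speed_gt0.
rewrite /calib1 /calib2 mulrAC -expr2 -[X in _ + X]mul1r -mulrDl addrC.
by rewrite -arc_speed_sqr expr2 mulfK.
Qed.

Lemma dcalib1_ge0 y : 0 <= dcalib1 y.
Proof.
rewrite /dcalib1 divr_ge0 ?exprn_ge0 ?(ltW (arc_speed_gt0 _))//.
by rewrite mulr_ge0 ?half_pow_ge0// (le_trans _ calib_const_ge3).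
Qed.

Lemma dcalib1_le y : dcalib1 y <= calib_const * half_pow k y.
Proof.
apply: ler_piMr; first by rewrite mulr_ge0 ?half_pow_ge0// (le_trans _ calib_const_ge3).
by rewrite invf_le1 ?exprn_gt0 ?arc_speed_gt0// exprn_ege1// arc_speed_ge1.
Qed.

(* [a u1 + b u2] is at most the speed, with a defect which controls both the
   backward motion in the second direction and the motion in the first one. *)
Lemma defect_bounds (a b u1 u2 : R) (d := Num.sqrt (u1 ^+ 2 + u2 ^+ 2) - a * u1 - b * u2) :
  0 <= a -> a <= 2^-1 -> 2^-1 <= b -> a ^+ 2 + b ^+ 2 = 1 ->
  [/\ 0 <= d, - u2 <= 2 * d & `|u1| <= 2 * (d + `|u2|)].
Proof.
move=> a0 a2 b2 ab1; set v := Num.sqrt _ in d *.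
have vu1 : `|u1| <= v.
  by rewrite -sqrtr_sqr ler_sqrt ?lerDl ?sqr_ge0// addr_ge0 ?sqr_ge0.
have uv : a * u1 + b * u2 <= v.
  apply: (le_trans (ler_norm _)); rewrite -sqrtr_sqr ler_sqrt; last first.
    by rewrite addr_ge0 ?sqr_ge0.
  have := sqr_ge0 (a * u2 - b * u1).
  have -> : u1 ^+ 2 + u2 ^+ 2 = (a ^+ 2 + b ^+ 2) * (u1 ^+ 2 + u2 ^+ 2).
    by rewrite ab1 mul1r.
  by nra.
have d0 : 0 <= d by rewrite /d; lra.
have au1 : a * u1 <= a * `|u1| by rewrite ler_wpM2l// ler_norm.
have b1 : b <= 1 by nra.
have bu2 : b * u2 <= `|u2|.
  by rewrite (le_trans (ler_norm _))// normrM ler_piMl// ger0_norm//; lra.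
have nu1 := normr_ge0 u1.
split => //; last by rewrite /d; nra.
by have [u20|u20] := leP 0 u2; rewrite /d; nra.
Qed.

End calibration.

Lemma le_of_sqr (R : realType) (x y : R) : 0 <= y -> x ^+ 2 <= y ^+ 2 -> x <= y.
Proof. by move=> y0 xy; have [//|yx] := leP x y; nra. Qed.

(* For [y >= M], put [j = w y / M] and [C = calib_const k] and combine
   [j <= j^3 / C^2 + C] with [8 w^3 h <= P^2], where [h = y^2 half_pow k y]. *)
Lemma calib_young (R : realType) (k : nat) (y w M : R)
    (Pyw := (w + half_pow k.+2 y) ^+ 2 - y ^+ (k.+2).*2.+1) :
  0 < M -> M <= 1 -> `|y| <= 1 -> `|Pyw| <= M ->
  dcalib1 k y * w <=
  2 * calib_const k ^+ 2 * M / Num.sqrt (M + `|y|) + (12 * M ^+ 2)^-1 * Pyw ^+ 2.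
Proof.
move=> M0 M1 y1 PM.
have C3 : 3 <= calib_const k :> R by exact: calib_const_ge3.
have d0 := dcalib1_ge0 k y; have d1 := dcalib1_le k y.
set C : R := calib_const k in C3 d1 *; set q := half_pow k y in d1 *.
have Cp : 0 <= C by lra.
have q0 : 0 <= q := half_pow_ge0 k y.
clearbody C.
have rhs1 : 0 <= 2 * C ^+ 2 * M / Num.sqrt (M + `|y|).
  by rewrite divr_ge0 ?sqrtr_ge0// !mulr_ge0 ?exprn_ge0// ltW.
have rhs2 : 0 <= (12 * M ^+ 2)^-1 * Pyw ^+ 2.
  by rewrite mulr_ge0 ?sqr_ge0// invr_ge0 mulr_ge0 ?sqr_ge0.
have [w0|w0] := leP w 0.
  by rewrite (@le_trans _ _ 0) ?addr_ge0// mulr_ge0_le0.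
have [y0|y0] := leP y 0.
  move: d1; rewrite /q half_pow_le0// mulr0 => d1.
  by rewrite (_ : dcalib1 k y = 0) ?mul0r ?addr_ge0//; apply/eqP; rewrite eq_le d1.
have w0' := ltW w0; have y0' := ltW y0; have M0' := ltW M0.
have Cpos : 0 < C by lra.
have hE : half_pow k.+2 y = q * y ^+ 2 by rewrite !half_powS /q; ring.
set h := half_pow k.+2 y in hE Pyw PM rhs2 *.
have h0 : 0 <= h := half_pow_ge0 _ _.
have PE : Pyw = w * (w + 2 * h).
  by rewrite /Pyw -half_pow_sqr ?ltW// -/h; ring.
have qy : q ^+ 2 <= y.
  have ys := half_pow_le_sqrt k (le_trans (ler_norm y) y1).
  rewrite -[leRHS](sqr_sqrtr (ltW y0)) ler_sqr ?nnegrE ?sqrtr_ge0//.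
rewrite (gtr0_norm y0) in y1 rhs1 *.
set S := Num.sqrt _ in rhs1 *.
have S2 : S ^+ 2 = M + y by rewrite sqr_sqrtr// addr_ge0// ltW.
have S0 : 0 < S by rewrite sqrtr_gt0 addr_gt0.
have S0' := ltW S0.
have qw0 : 0 <= q * w by exact: mulr_ge0.
have P0 : 0 <= Pyw.
  rewrite PE; apply: mulr_ge0 => //; apply: addr_ge0 => //. exact: mulr_ge0.
rewrite (ger0_norm P0) in PM.
have {d1} dw : dcalib1 k y * w <= C * (q * w) by rewrite mulrA ler_wpM2r// ltW.
apply: (le_trans dw).
(* Below height [M], q^2 <= y and w^2 <= Pyw make both [q] and [w] at most sqrt M, so q w <= M and
   the first summand suffices. *)
have [yM|My] := ltP y M.
  apply: ler_wpDr => //.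
  have w2 : w ^+ 2 <= M by apply: le_trans PM; rewrite PE; nra.
  have qw : q * w <= M.
    apply: le_of_sqr => //; rewrite exprMn [M ^+ 2]expr2.
    by apply: ler_pM; rewrite ?sqr_ge0//; lra.
  have S2' : S <= 2 by apply: le_of_sqr => //; rewrite S2; lra.
  rewrite ler_pdivlMr//.
  have : q * w * S <= M * 2 by exact: ler_pM.
  have CC : C <= C ^+ 2 by nra.
  have := ler_wpM2r M0' CC; nra.
(* Multiplied by C M q / y, the cubic term becomes w^3 h / (C M^2), which P^2 absorbs since 8 C >=
   12. The constant becomes C^2 M q / y <= C^2 M / sqrt y, and here y >= (M + y) / 2. *)
pose j := w * y / M.
have j0 : 0 <= j by apply: divr_ge0 => //; exact: mulr_ge0.
have jC : j <= j ^+ 3 / C ^+ 2 + C.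
  have [jl|jl] := leP j C; first by apply: ler_wpDl => //; rewrite divr_ge0 ?exprn_ge0// ltW.
  apply: ler_wpDr; first exact: ltW.
  rewrite ler_pdivlMr ?exprn_gt0// [j ^+ 3]exprS ler_wpM2l//.
  by rewrite ler_sqr ?nnegrE// ltW.
have E1 : C * (q * w) = (C * M / y * q) * j.
  by rewrite /j; field; rewrite !gt_eqF.
have E2 : (C * M / y * q) * (j ^+ 3 / C ^+ 2 + C) =
    w ^+ 3 * h / (C * M ^+ 2) + C ^+ 2 * M * (q / y).
  by rewrite hE /j; field; rewrite !gt_eqF.
have cq0 : 0 <= C * M / y * q by rewrite mulr_ge0// divr_ge0// mulr_ge0.
rewrite E1; apply: (le_trans (ler_wpM2l cq0 jC)); rewrite E2 addrC.
apply: lerD.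
  have -> : 2 * C ^+ 2 * M / S = C ^+ 2 * M * (2 / S) by ring.
  rewrite ler_wpM2l ?mulr_ge0 ?exprn_ge0//.
  rewrite ler_pdivrMr// mulrAC ler_pdivlMr//.
  apply: le_of_sqr; first exact: mulr_ge0.
  by rewrite exprMn S2; nra.
have MC : 0 < C * M ^+ 2 by rewrite mulr_gt0// exprn_gt0.
rewrite ler_pdivrMr//.
have -> : (12 * M ^+ 2)^-1 * Pyw ^+ 2 * (C * M ^+ 2) = Pyw ^+ 2 * (C / 12).
  by field; rewrite gt_eqF.
have w3 : 8 * (w ^+ 3 * h) <= Pyw ^+ 2.
  have -> : Pyw ^+ 2 = 8 * (w ^+ 3 * h) + w ^+ 2 * (w - 2 * h) ^+ 2.
    by rewrite PE; ring.
  by rewrite lerDl mulr_ge0 ?sqr_ge0.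
have := ler_wpM2r (_ : 0 <= C / 12) w3.
have wh : 0 <= w ^+ 3 * h by rewrite mulr_ge0// exprn_ge0// ltW.
move=> /(_ _)/le_trans; nra.
Qed.

(** * Minimality and uniqueness *)

Lemma ac_within_continuous (R : realType) (a b : R) (f : R -> R) :
  absolutely_continuous a b f -> {within `[a, b], continuous f}.
Proof.
move=> acf; apply/subspace_continuousP => t /=; rewrite in_itv/= => /andP[at_ tb].
apply/cvgrPdist_lt => e e0; have [d d0 H] := ac_continuity acf e0.
rewrite near_withinE; near=> s; rewrite /= in_itv/= => /andP[as_ sb].
have ts : `|t - s| < d by near: s; exact: cvgr_dist_lt.
have [st|/ltW st] := leP s t.
  by apply: H => //; rewrite -(ger0_norm (_ : 0 <= t - s)) ?subr_ge0.
rewrite distrC; apply: H => //.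
by rewrite -(ger0_norm (_ : 0 <= s - t)) ?subr_ge0// distrC.
Unshelve. all: by end_near. Qed.

(* [(x, y)] is a path in the plane from the origin, [z] the third coordinate of
   its horizontal lift and [ell] a primitive of its speed. *)
Definition lifted_path (R : realType) (k : nat) (T : R) (x y z ell : R -> R) :=
  [/\ 0 < T,
      [/\ absolutely_continuous 0 T x, absolutely_continuous 0 T y &
          absolutely_continuous 0 T z],
      [/\ x 0 = 0, y 0 = 0, z 0 = 0 & ell 0 = 0],
      forall u v, u <= v -> ell u <= ell v &
      {ae mu, forall t, 0 < t -> t < T -> exists u1 u2 : R,
        [/\ is_derive t 1 x u1, is_derive t 1 y u2,
            is_derive t 1 z ((x t ^+ 2 - y t ^+ (k.+2).*2.+1) ^+ 2 * u2) &
            is_derive t 1 ell (Num.sqrt (u1 ^+ 2 + u2 ^+ 2))]}].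

Lemma norm_le_speed (R : realType) (u1 u2 : R) :
  `|u1| <= Num.sqrt (u1 ^+ 2 + u2 ^+ 2) /\ `|u2| <= Num.sqrt (u1 ^+ 2 + u2 ^+ 2).
Proof.
by split; rewrite -sqrtr_sqr ler_sqrt ?lerDl ?lerDr ?addr_ge0 ?sqr_ge0.
Qed.

(** [s * f + ell] is nondecreasing for both signs [s]. Applied to the plane coordinates, this
    confines a path to a box whose half-width is its length. *)
Lemma norm_le_primitive (R : realType) (T : R) (f ell : R -> R) :
  absolutely_continuous 0 T f -> f 0 = 0 -> ell 0 = 0 ->
  (forall u v, u <= v -> ell u <= ell v) ->
  {ae mu, forall t, 0 < t -> t < T -> exists u v,
     [/\ is_derive t 1 f u, is_derive t 1 ell v & `|u| <= v]} ->
  forall t, 0 <= t -> t <= T -> `|f t| <= ell T.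
Proof.
move=> acf f0 ell0 ndell df t t0 tT.
apply: (@le_trans _ _ (ell t)); last exact: ndell.
have nd (s : R) : `|s| = 1 -> - (s * f t) <= ell t.
  move=> s1.
  suff : s * f 0 + ell 0 <= s * f t + ell t by rewrite f0 ell0; lra.
  apply: (ac_nondecreasing (b := T) (acMl s acf)) => //.
    by move=> u v _ uv _; exact: ndell.
  apply: ae_imply df => u h u0 uT; have [p [q [dp dq pq]]] := h u0 uT.
  exists (s * p + q); last exact: deriv_add (deriv_scale s dp) dq.
  have := ler_norm (- (s * p)); rewrite normrN normrM s1 mul1r; lra.
rewrite ler_norml; apply/andP; split.
  by have := nd 1; rewrite normr1 mul1r => /(_ erefl); lra.
by have := nd (-1); rewrite normrN1 mulN1r opprK => /(_ erefl).
Qed.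

(** The product is the one met at the end of [Pxy_eq0], where 120 (4 + m) C^2 r must be less than 1,
    with C = [calib_const k]. The margin up to 500 lets the other smallness conditions follow from C
    >= 3. *)
Definition small_radius (R : realType) (k : nat) (r : R) :=
  500 * (4 + ((k.+2).*2.+1)%:R) * calib_const k ^+ 2 * r <= 1.

Section small_radius_bounds.
Context {R : realType} (k : nat) (r : R).
Context (r0 : 0 <= r) (hr : small_radius k r).

Lemma small_radius_le : [/\ 500 * r <= 1, 500 * (calib_const k * r) <= 1,
  500 * (calib_const k ^+ 2 * r) <= 1 &
  500 * ((4 + ((k.+2).*2.+1)%:R) * r * calib_const k ^+ 2) <= 1].
Proof.
have C3 : 3 <= calib_const k :> R by exact: calib_const_ge3.
have m0 : 0 <= ((k.+2).*2.+1)%:R :> R by [].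
move: hr; rewrite /small_radius; move: C3 m0.
move: (calib_const k : R) (((k.+2).*2.+1)%:R : R) => C m C3 m0 H.
have CC : C * 1 <= C ^+ 2 by nra.
have r1 : 1 * r <= C * r by rewrite ler_wpM2r//; lra.
have r2 : C * 1 * r <= C ^+ 2 * r by rewrite ler_wpM2r.
have r3 : 1 * (C ^+ 2 * r) <= (4 + m) * (C ^+ 2 * r).
  by rewrite ler_wpM2r ?mulr_ge0 ?sqr_ge0//; lra.
by split; lra.
Qed.

Lemma slope_small y : `|y| <= r -> slope k y <= 500^-1.
Proof.
move=> yr; have [h1 h2 _ _] := small_radius_le.
have y1 : `|y| <= 1 by lra.
have hp := half_pow_norm_le k y1.
have mb0 : 0 <= mbar k :> R := ltW (mbar_gt0 _).
have mbC : mbar k <= calib_const k :> R.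
  rewrite /calib_const ler_peMr// -(natr1 k).
  by have : 0 <= k%:R :> R by []; lra.
have : slope k y <= calib_const k * r.
  rewrite /slope; apply: ler_pM => //; first exact: half_pow_ge0.
  exact: le_trans yr.
by lra.
Qed.

Lemma arc_speed_small y : `|y| <= r -> arc_speed k y <= 2.
Proof.
move=> yr; have := slope_small yr; have := slope_ge0 k y => s0 s1.
apply: le_of_sqr => //; rewrite arc_speed_sqr; nra.
Qed.

Lemma calib_small y : `|y| <= r ->
  [/\ 0 <= calib1 k y, calib1 k y <= 2^-1 & 2^-1 <= calib2 k y].
Proof.
move=> yr; have := slope_small yr; have := slope_ge0 k y => s0 s1.
have a0 := arc_speed_gt0 k y; have a1 := arc_speed_ge1 k y.
split; first by rewrite divr_ge0// ltW.
  by rewrite ler_pdivrMr//; lra.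
by rewrite lef_pV2 ?posrE// arc_speed_small.
Qed.

Lemma dcalib1_small y : `|y| <= r -> dcalib1 k y <= calib_const k.
Proof.
move=> yr; have [h1 _ _ _] := small_radius_le.
have C3 : 3 <= calib_const k :> R by exact: calib_const_ge3.
apply: (le_trans (dcalib1_le k y)); rewrite ler_piMr//; first by lra.
have y1 : y <= 1 by apply: (le_trans (ler_norm y)); lra.
by apply: (le_trans (half_pow_le_sqrt k y1)); rewrite -[leRHS]sqrtr1 ler_sqrt.
Qed.

End small_radius_bounds.

(** * The energy of a path and its rate of increase *)

Section energy.
Context {R : realType} (k : nat) (T r M s : R) (x y z ell S F f : R -> R).
Let w t := x t - half_pow k.+2 (y t).
Let Pxy t := x t ^+ 2 - y t ^+ (k.+2).*2.+1.
Context (path : lifted_path k T x y z ell)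
  (r0 : 0 <= r) (hr : small_radius k r)
  (xr : forall t, 0 <= t -> t <= T -> `|x t| <= r)
  (yr : forall t, 0 <= t -> t <= T -> `|y t| <= r)
  (dS : forall q : R, `|q| < 1 -> is_derive q 1 S (arc_speed k q))
  (dF : forall q : R, `|q| < 1 -> is_derive q 1 F (f q))
  (f0 : forall q : R, 0 <= f q) (f12 : forall q : R, f q <= 12^-1)
  (s0 : 0 <= s) (sM : s * M ^+ 2 <= 12^-1)
  (PM : forall t, 0 <= t -> t <= T -> `|Pxy t| <= M)
  (young : forall t, 0 <= t -> t <= T ->
     dcalib1 k (y t) * w t <= f (y t) + s * Pxy t ^+ 2).

(** The energy is [energy_ac + 2 * ell]. The derivative of S(y) + a w is a x' + b y' + a' w y', so
    subtracting it from the speed leaves the defect and the term - a' w y', which [F] and [s * z]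
    compensate. The factor 2 leaves room for y' < 0. *)
Definition energy_ac t :=
  2 * (F (y t) + s * z t - (S (y t) + calib1 k (y t) * w t)).

Let y1 (t : R) : 0 <= t -> t <= T -> `|y t| < 1.
Proof.
move=> t0 tT; have [h _ _ _] := small_radius_le r0 hr.
by apply: (le_lt_trans (yr t0 tT)); lra.
Qed.

Lemma deviation_le t : 0 <= t -> t <= T -> `|w t| <= 2 * r.
Proof.
move=> t0 tT; have h := half_pow_norm_le k.+1 (ltW (y1 t0 tT)).
have h0 := half_pow_ge0 k.+2 (y t).
rewrite /w (le_trans (ler_normB _ _))// (ger0_norm h0).
have := xr t0 tT; have := yr t0 tT; lra.
Qed.

Lemma ac_path_comp (G G' : R -> R) (K : R) :
  (forall q : R, `|q| <= r -> is_derive q 1 G (G' q)) ->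
  (forall q : R, `|q| <= r -> `|G' q| <= K) ->
  absolutely_continuous 0 T (fun t => G (y t)).
Proof.
move=> dG GK; have [_ [_ acy _] _ _ _] := path.
apply: (ac_comp (c := - r) (d := r) (K := K) acy).
  by move=> t t0 tT; rewrite -ler_norml yr.
move=> u v ru uv vr.
have uvr (q : R) : u <= q -> q <= v -> `|q| <= r.
  by move=> uq qv; rewrite ler_norml; apply/andP; split; lra.
have := @deriv_increment_bound _ G G' u v 0 K uv; rewrite mul0r subr0; apply.
  by move=> q uq qv; apply: dG; exact: uvr.
by move=> q uq qv; rewrite subr0; apply: GK; exact: uvr.
Qed.

Lemma ac_energy : absolutely_continuous 0 T energy_ac.
Proof.
have [T0 [acx acy acz] _ _ _] := path.
have [h1 h2 h3 h4] := small_radius_le r0 hr.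
have r1 (q : R) : `|q| <= r -> `|q| < 1 by lra.
have acN (g : R -> R) : absolutely_continuous 0 T g -> absolutely_continuous 0 T (fun t => - g t).
  by move=> acg; have := acMl (-1) acg; under eq_fun do rewrite mulN1r.
have acw : absolutely_continuous 0 T w.
  apply: acD => //; apply: acN.
  apply: (@ac_path_comp _ (slope k) (500^-1)) => q qr; first exact: height_derive.
  by rewrite ger0_norm ?slope_ge0// (slope_small r0 hr).
apply: acMl; apply: acD.
  apply: acD; last exact: acMl.
  apply: (@ac_path_comp _ f (12^-1)) => q qr; first by apply: dF; exact: r1.
  by rewrite ger0_norm.
apply: acN; apply: acD.
  apply: (@ac_path_comp _ (arc_speed k) 2) => q qr; first by apply: dS; exact: r1.
  by rewrite ger0_norm ?(arc_speed_small r0 hr)// ltW ?arc_speed_gt0.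
apply: (@acM _ _ _ 1) => //.
- apply: (@ac_path_comp _ (dcalib1 k) (calib_const k)) => q qr; first exact: calib1_derive.
  by rewrite ger0_norm ?dcalib1_ge0// (dcalib1_small r0 hr).
- move=> t t0 tT; have [a0 a1 _] := calib_small r0 hr (yr t0 tT).
  by rewrite ger0_norm//; lra.
- by move=> t t0 tT; apply: (le_trans (deviation_le t0 tT)); lra.
Qed.

(** The derivative of the energy is 2 d + 2 g y' with g = f + s P^2 - a' w. The hypothesis [young]
    gives g >= 0, and each of the three summands is at most 1/12, so g <= 1/4. When y' < 0, the
    bound |y'| <= 2 d then makes the loss 2 g |y'| at most d. *)
Lemma energy_derive : {ae mu, forall t, 0 < t -> t < T -> exists u1 u2 d e : R,
  [/\ [/\ is_derive t 1 x u1, is_derive t 1 y u2 &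
          is_derive t 1 z (Pxy t ^+ 2 * u2)],
      is_derive t 1 (fun q => energy_ac q + 2 * ell q) e,
      0 <= d <= e, - u2 <= 2 * d & `|u1| <= 2 * (d + `|u2|)]}.
Proof.
have [_ _ _ _ dpath] := path.
apply: ae_imply dpath => t h t0 tT; have [u1 [u2 [dx dy dz dl]]] := h t0 tT.
have {t0 tT} [t0 tT] : 0 <= t /\ t <= T by split; exact: ltW.
have [a0 a1 b1] := calib_small r0 hr (yr t0 tT).
have [d0 du2 du1] := defect_bounds u1 u2 a0 a1 b1 (calib_unit k (y t)).
set d := Num.sqrt _ - _ - _ in d0 du2 du1.
pose e := 2 * (f (y t) * u2 + s * (Pxy t ^+ 2 * u2) - (arc_speed k (y t) * u2 +
  (dcalib1 k (y t) * u2 * w t + calib1 k (y t) * (u1 - slope k (y t) * u2)))) +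
  2 * Num.sqrt (u1 ^+ 2 + u2 ^+ 2).
have dFy := deriv_comp (dF (y1 t0 tT)) dy.
have dSy := deriv_comp (dS (y1 t0 tT)) dy.
have dcy := deriv_comp (calib1_derive k (y t)) dy.
have dw := deriv_sub dx (deriv_comp (height_derive k (y t)) dy).
have dE := deriv_add (deriv_scale 2 (deriv_sub (deriv_add dFy (deriv_scale s dz))
  (deriv_add dSy (deriv_mul dcy dw)))) (deriv_scale 2 dl).
exists u1, u2, d, e; split => //.
rewrite d0 /=.
have -> : e = 2 * d + 2 * (f (y t) + s * Pxy t ^+ 2 - dcalib1 k (y t) * w t) * u2.
  by rewrite /e /d -(calib1_slope k (y t)); ring.
have P2 : Pxy t ^+ 2 <= M ^+ 2.
  by rewrite -(real_normK (num_real (Pxy t))) lerXn2r ?nnegrE ?PM// (le_trans _ (PM t0 tT)).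
have sP : s * Pxy t ^+ 2 <= 12^-1.
  by apply: le_trans sM; rewrite ler_wpM2l.
have sP0 : 0 <= s * Pxy t ^+ 2 by rewrite mulr_ge0// sqr_ge0.
have aw : - (dcalib1 k (y t) * w t) <= 12^-1.
  have [_ h2 _ _] := small_radius_le r0 hr.
  apply: (le_trans (ler_norm _)); rewrite normrN normrM (ger0_norm (dcalib1_ge0 _ _)).
  have Cr : dcalib1 k (y t) * `|w t| <= calib_const k * (2 * r).
    apply: ler_pM; rewrite ?dcalib1_ge0//; last exact: deviation_le.
    exact: (dcalib1_small r0 hr (yr t0 tT)).
  by apply: (le_trans Cr); lra.
have yg := young t0 tT; have := f0 (y t); have := f12 (y t).
set g := f (y t) + _ - _; move=> g1 g2.
have gg : 0 <= g <= 4^-1 by rewrite /g; apply/andP; split; lra.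
move: gg => /andP[gg0 gg1].
have [u20|u20] := leP 0 u2.
  by have : 0 <= g * u2 by [rewrite mulr_ge0|]; lra.
have : g * (- u2) <= 4^-1 * (- u2) by rewrite ler_wpM2r//; lra.
lra.
Qed.

End energy.

(** * Rigidity of the paths that are no longer than the curve *)

Section rigidity.
Context {R : realType} (k : nat) (T e : R) (x y z ell S : R -> R).
Let Pxy t := x t ^+ 2 - y t ^+ (k.+2).*2.+1.
Let r := 2 * e.
Context (path : lifted_path k T x y z ell) (e0 : 0 < e)
  (hr : small_radius k r)
  (dS : forall q : R, `|q| < 1 -> is_derive q 1 S (arc_speed k q)) (S0 : S 0 = 0)
  (xT : x T = half_pow k.+2 e) (yT : y T = e) (zT : z T = 0) (ellT : ell T <= S e).

Let r0 : 0 <= r. Proof. by rewrite mulr_ge0// ltW. Qed.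

Let r1 : 500 * r <= 1. Proof. by have [] := small_radius_le r0 hr. Qed.

(** The radius r = 2 e comes from here: [arc_speed] is at most 2 up to height [e]. A path no longer
    than the curve therefore has both plane coordinates bounded by [r]. *)
Lemma arc_length_le : S e <= r.
Proof.
have dS' q : 0 <= q -> q <= e -> is_derive q 1 S (arc_speed k q).
  by move=> q0 qe; apply: dS; rewrite ger0_norm//; move: r1; rewrite /r; lra.
have := deriv_increment_bound (c := 0) (K := 2) (ltW e0) dS'.
rewrite mul0r !subr0 S0 subr0 => H; apply: (le_trans (ler_norm _)); apply: H => q q0 qe.
rewrite subr0 ger0_norm ?(ltW (arc_speed_gt0 _ _))//.
by apply: (arc_speed_small r0 hr); rewrite ger0_norm// /r; lra.
Qed.

Lemma path_bounded t : 0 <= t -> t <= T -> `|x t| <= r /\ `|y t| <= r.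
Proof.
have [T0 [acx acy acz] [x0 y0 z0 ell0] ndell dpath] := path.
have le_r := le_trans ellT arc_length_le.
by move=> t0 tT; split; apply: le_trans le_r; apply: norm_le_primitive t0 tT => //;
  apply: ae_imply dpath => q h q0 qT; have [u1 [u2 [dx dy _ dl]]] := h q0 qT;
  [exists u1|exists u2]; exists (Num.sqrt (u1 ^+ 2 + u2 ^+ 2)); split => //;
  have [] := norm_le_speed u1 u2.
Qed.

Let xr t : 0 <= t -> t <= T -> `|x t| <= r.
Proof. by move=> t0 tT; have [] := path_bounded t0 tT. Qed.

Let yr t : 0 <= t -> t <= T -> `|y t| <= r.
Proof. by move=> t0 tT; have [] := path_bounded t0 tT. Qed.

Lemma pow_small (q : R) n : `|q| <= r -> `|q ^+ n.+1| <= r.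
Proof.
move=> qr; have q1 : `|q| <= 1 by move: r1; lra.
by apply: le_trans qr; rewrite normrX exprS ler_piMr// exprn_ile1.
Qed.

Lemma ac_Pxy : absolutely_continuous 0 T Pxy.
Proof.
have [T0 [acx acy acz] _ _ _] := path.
apply: acD; first by apply: (@acM _ _ _ r).
have : absolutely_continuous 0 T (fun t => y t ^+ k.+2.*2.+1).
  apply: (ac_path_comp (r := r) (G := fun q => q ^+ k.+2.*2.+1)
    (G' := fun q => (k.+2.*2.+1)%:R * q ^+ k.+2.*2 * 1)
    (K := (k.+2.*2.+1)%:R) path yr) => // q qr.
    exact: (deriv_pow k.+2.*2.+1 (is_derive_id q 1)).
  rewrite mulr1 normrM ger0_norm ?ler0n// ler_piMr ?ler0n//.
  by rewrite (le_trans (pow_small _ qr))//; move: r1; lra.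
by move=> /(acMl (-1)); under eq_fun do rewrite mulN1r.
Qed.

(** Being quadratic in [r], this bound makes sqrt M of order r, which keeps [f] below 1/12 in
    [Pxy_eq0]. *)
Lemma Pxy_le t : 0 <= t -> t <= T -> `|Pxy t| <= 2 * r ^+ 2.
Proof.
move=> t0 tT; rewrite /Pxy (le_trans (ler_normB _ _))// mulr2n mulrDl mul1r.
apply: lerD.
  by rewrite normrX lerXn2r ?nnegrE// xr.
rewrite (_ : k.+2.*2.+1 = (k.+1.*2.+1 + 2)%N); last by rewrite addn2 !doubleS.
rewrite exprD normrM normrX -[leRHS]mul1r; apply: ler_pM => //.
  by rewrite exprn_ile1//; have := yr t0 tT; move: r1; lra.
by rewrite normrX lerXn2r ?nnegrE// yr.
Qed.

Lemma sup_Pxy : exists2 t, 0 <= t <= T &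
  forall q, 0 <= q -> q <= T -> `|Pxy q| <= `|Pxy t|.
Proof.
have [T0 _ _ _ _] := path.
have acP : absolutely_continuous 0 T (fun t => `|Pxy t|).
  apply: (ac_dominated (K := 1) ac_Pxy ac_Pxy) => u v _ _ _.
  by rewrite mul1r (le_trans (ler_dist_dist _ _))// lerDl.
have [t tT H] := EVT_max (ltW T0) (ac_within_continuous acP).
exists t; first by move: tT; rewrite in_itv.
by move=> q q0 qT; apply: H; rewrite in_itv/= q0.
Qed.

Section energy_inequalities.
Context (M : R) (A : R -> R) (acA : absolutely_continuous 0 T A)
  (PM : forall t, 0 <= t -> t <= T -> `|Pxy t| <= M)
  (dA : {ae mu, forall t, 0 < t -> t < T -> exists u1 u2 d e : R,
    [/\ [/\ is_derive t 1 x u1, is_derive t 1 y u2 &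
            is_derive t 1 z (Pxy t ^+ 2 * u2)],
        is_derive t 1 (fun q => A q + 2 * ell q) e,
        0 <= d <= e, - u2 <= 2 * d & `|u1| <= 2 * (d + `|u2|)]}).

(** [A] stays abstract because two energies are fed in: one tuned to M > 0 in [Pxy_eq0], and one
    with F = 0, s = 0 in [rigidity_of_curve], where M = 0. *)
Let E t := A t + 2 * ell t.

(* Every quantity below is a combination of absolutely continuous functions and
   of a nonnegative multiple of the primitive of the speed. *)
Lemma energy_combination (c : R) (g : R -> R) : 0 <= c ->
  absolutely_continuous 0 T g ->
  (forall (t u1 u2 d e' : R), 0 <= t -> t <= T ->
     is_derive t 1 x u1 -> is_derive t 1 y u2 ->
     is_derive t 1 z (Pxy t ^+ 2 * u2) ->
     0 <= d -> d <= e' -> - u2 <= 2 * d -> `|u1| <= 2 * (d + `|u2|) ->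
     exists2 l, 0 <= c * e' + l & is_derive t 1 g l) ->
  forall u v, 0 <= u -> u <= v -> v <= T -> c * E u + g u <= c * E v + g v.
Proof.
move=> c0 acg dg u v u0 uv vT; have [_ _ _ ndell _] := path.
have EE t : c * E t + g t = (c * A t + g t) + 2 * c * ell t by rewrite /E; ring.
rewrite !EE; refine (ac_nondecreasing (A := fun t => c * A t + g t)
  (N := fun t => 2 * c * ell t) _ _ _ u0 uv vT).
- by apply: acD => //; exact: acMl.
- by move=> p q _ pq _; rewrite ler_wpM2l ?mulr_ge0// ndell.
apply: ae_imply dA => t h t0 tT.
have [u1 [u2 [d [e' [[dx dy dz] de /andP[d0 ed] h1 h2]]]]] := h t0 tT.
have [l l0 dl] := dg t u1 u2 d e' (ltW t0) (ltW tT) dx dy dz d0 ed h1 h2.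
exists (c * e' + l) => //.
have := deriv_add (deriv_scale c de) dl.
rewrite (_ : (fun q => _) = fun q => c * A q + g q + 2 * c * ell q)//.
by apply/funext => q; ring.
Qed.

Lemma ac_cst (a : R) : absolutely_continuous 0 T (fun=> a).
Proof.
by apply: (ac_lipschitz (K := 0)) => u v _ _ _; rewrite subrr normr0 mul0r.
Qed.

Lemma energy_nondecreasing u v : 0 <= u -> u <= v -> v <= T -> E u <= E v.
Proof.
move=> u0 uv vT.
have := @energy_combination 1 (fun=> 0) ler01 (ac_cst 0) _ u v u0 uv vT.
rewrite !addr0 !mul1r; apply => t u1 u2 d e' _ _ _ _ _ d0 de _ _.
by exists 0; [lra|exact: is_derive_cst].
Qed.

(** Since 2 E' >= 2 d >= - y'. When the total gain of [E] is zero, this makes [y] nondecreasing. *)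
Lemma second_coord_energy u v : 0 <= u -> u <= v -> v <= T ->
  2 * E u + y u <= 2 * E v + y v.
Proof.
have [T0 [_ acy _] _ _ _] := path.
apply: energy_combination => // t u1 u2 d e' _ _ _ dy _ d0 de h _.
by exists u2 => //; lra.
Qed.

Let M0 : 0 <= M.
Proof.
have [T0 _ _ _ _] := path.
exact: le_trans (normr_ge0 _) (PM (lexx 0) (ltW T0)).
Qed.

Let PM2 t : 0 <= t -> t <= T -> Pxy t ^+ 2 <= M ^+ 2.
Proof.
move=> t0 tT.
by rewrite -(real_normK (num_real (Pxy t))) lerXn2r ?nnegrE ?PM.
Qed.

(** Since z' = P^2 y' >= - 2 P^2 d. In [cube_le] it bounds [z t] by the energy still to be gained
    before [z] returns to 0; for M = 0 it makes [z] nondecreasing. *)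
Lemma third_coord_energy u v : 0 <= u -> u <= v -> v <= T ->
  2 * M ^+ 2 * E u + z u <= 2 * M ^+ 2 * E v + z v.
Proof.
have [T0 [_ _ acz] _ _ _] := path.
apply: energy_combination => //; first by rewrite mulr_ge0// sqr_ge0.
move=> t u1 u2 d e' t0 tT _ _ dz d0 de h _.
exists (Pxy t ^+ 2 * u2) => //.
have h1 : - (Pxy t ^+ 2 * u2) <= Pxy t ^+ 2 * (2 * d).
  by rewrite -mulrN ler_wpM2l ?sqr_ge0.
have h2 : Pxy t ^+ 2 * (2 * d) <= M ^+ 2 * (2 * e').
  by apply: ler_pM; rewrite ?sqr_ge0 ?PM2//; lra.
lra.
Qed.

(** The constant in |P'| <= kappa (d + |y'|): the 4 comes from 2 x x' with |x'| <= 2 (d + |y'|), the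
    other summand from differentiating y^m. *)
Let kappa := (4 + ((k.+2).*2.+1)%:R) * r.

Let kappa0 : 0 <= kappa.
Proof. by rewrite mulr_ge0// addr_ge0. Qed.

(* The cube makes the weight [P ^ 2] of the third coordinate appear. *)
Lemma cube_energy (s : R) u v : `|s| = 1 -> 0 <= u -> u <= v -> v <= T ->
  15 * kappa * M ^+ 2 * E u + (3 * kappa * z u + s * Pxy u ^+ 3) <=
  15 * kappa * M ^+ 2 * E v + (3 * kappa * z v + s * Pxy v ^+ 3).
Proof.
move=> s1 u0 uv vT; have [T0 [acx acy acz] _ _ _] := path.
refine (energy_combination (g := fun t => 3 * kappa * z t + s * Pxy t ^+ 3)
  _ _ _ u0 uv vT).
- by apply: mulr_ge0; [exact: mulr_ge0|exact: sqr_ge0].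
- apply: acD; first exact: acMl.
  apply: acMl.
  have -> : (fun t => Pxy t ^+ 3) = fun t => Pxy t * (Pxy t * Pxy t).
    by apply/funext => t; rewrite !exprS expr0 mulr1.
  have Pr t : 0 <= t -> t <= T -> `|Pxy t| <= 1.
    move=> t0 tT; apply: (le_trans (Pxy_le t0 tT)); rewrite expr2.
    by move: r1 r0 => h1 h2; nra.
  have acP2 : absolutely_continuous 0 T (fun t => Pxy t * Pxy t).
    by apply: (acM (K := 1)) => //; exact: ac_Pxy.
  apply: (acM (K := 1)) => //; first exact: ac_Pxy.
  by move=> t t0 tT; rewrite normrM mulr_ile1 ?Pr.
move=> t u1 u2 d e' t0 tT dx dy dz d0 de h1 h2.
pose dP := 2%:R * x t ^+ 1 * u1 - (k.+2.*2.+1)%:R * y t ^+ k.+2.*2 * u2.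
have dPxy : is_derive t 1 Pxy dP.
  exact: deriv_sub (deriv_pow 2 dx) (deriv_pow k.+2.*2.+1 dy).
exists (3 * kappa * (Pxy t ^+ 2 * u2) + s * (3%:R * Pxy t ^+ 2 * dP)); last first.
  exact: deriv_add (deriv_scale _ dz) (deriv_scale _ (deriv_pow 3 dPxy)).
(* From - u2 <= 2 d follows |u2| <= u2 + 4 d. Trading |u2| for u2 turns P^2 |u2| into the derivative
   of [z]; the resulting 5 d, times the 3 from the cube, gives 15. *)
have dPle : `|dP| <= kappa * (5 * d + u2).
  rewrite /dP expr1 (le_trans (ler_normB _ _))//.
  have nu2 : `|u2| <= u2 + 4 * d.
    by have [|] := leP 0 u2 => ?; [rewrite ger0_norm|rewrite ltr0_norm]; lra.
  have yk : `|y t ^+ k.+2.*2| <= r by rewrite doubleS; exact/pow_small/yr.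
  have norm3 (a b c : R) : 0 <= a -> `|a * b * c| = a * `|b| * `|c|.
    by move=> a0; rewrite 2!normrM ger0_norm.
  rewrite !norm3 ?ler0n//.
  have xu : `|x t| * `|u1| <= r * (2 * (d + `|u2|)) by apply: ler_pM; rewrite ?xr.
  have yu : `|y t ^+ k.+2.*2| * `|u2| <= r * (d + `|u2|).
    by apply: ler_pM => //; lra.
  apply: (@le_trans _ _ (kappa * (d + `|u2|))); last by rewrite ler_wpM2l//; lra.
  have aux (X U1 Y U2 N : R) : 0 <= N -> X * U1 <= r * (2 * (d + U2)) ->
      Y * U2 <= r * (d + U2) ->
      2 * X * U1 + N * Y * U2 <= (4 + N) * r * (d + U2).
    by move=> N0 h3 h4; have := ler_wpM2l N0 h4; lra.
  exact: (aux _ _ _ _ _ (ler0n R _) xu yu).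
have sdP : - (s * dP) <= kappa * (5 * d + u2).
  by apply: le_trans dPle; rewrite (le_trans (ler_norm _))// normrN normrM s1 mul1r.
have P2 := PM2 t0 tT; have P20 := sqr_ge0 (Pxy t).
have h3 := ler_wpM2l P20 sdP.
have h4 : Pxy t ^+ 2 * d <= M ^+ 2 * e' by apply: ler_pM.
have h5 := ler_wpM2l kappa0 h4.
have -> : 15 * kappa * M ^+ 2 * e' +
   (3 * kappa * (Pxy t ^+ 2 * u2) + s * (3%:R * Pxy t ^+ 2 * dP)) =
   15 * (kappa * (M ^+ 2 * e')) + 3 * (kappa * (Pxy t ^+ 2 * u2)) -
   3 * (Pxy t ^+ 2 * - (s * dP)) by ring.
have h6 : Pxy t ^+ 2 * (kappa * (5 * d + u2)) =
  5 * (kappa * (Pxy t ^+ 2 * d)) + kappa * (Pxy t ^+ 2 * u2) by ring.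
lra.
Qed.

(** From 0 to [t], [cube_energy] with both signs bounds |P|^3 by 15 kappa M^2 times the energy
    gained, plus 3 kappa z(t). As [z T = 0], [third_coord_energy] bounds the last term by 6 kappa
    M^2 times the energy gained after [t]. *)
Lemma cube_le t : 0 <= t -> t <= T ->
  `|Pxy t| ^+ 3 <= 15 * kappa * M ^+ 2 * (E T - E 0).
Proof.
move=> t0 tT; have [T0 _ [x0 y0 z0 _] _ _] := path.
have P0 : Pxy 0 = 0 by rewrite /Pxy x0 y0 !expr0n subrr.
have h1 (s : R) : `|s| = 1 -> - (s * Pxy t ^+ 3) <=
    15 * kappa * M ^+ 2 * (E t - E 0) + 3 * kappa * z t.
  by move=> s1; have := cube_energy s1 (lexx 0) t0 tT; rewrite P0 z0 expr0n/= !mulr0; lra.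
have h2 := ler_wpM2l kappa0 (third_coord_energy t0 tT (lexx T)).
rewrite zT in h2.
have h3 : 0 <= kappa * (M ^+ 2 * (E T - E t)).
  apply: mulr_ge0 => //; apply: mulr_ge0; first exact: sqr_ge0.
  by rewrite subr_ge0; exact: energy_nondecreasing.
rewrite -normrX ler_norml.
have := h1 1; rewrite normr1 => /(_ erefl); have := h1 (-1).
rewrite normrN1 => /(_ erefl) h4 h5; apply/andP; split; lra.
Qed.

End energy_inequalities.

(** At both ends w = z = 0, and [ell T <= S e] cancels the arc length term. *)
Lemma energy_gap (s : R) (F : R -> R) (A := energy_ac k s x y z S F) :
  A T + 2 * ell T - (A 0 + 2 * ell 0) <= 2 * (F e - F 0).
Proof.
have [_ _ [x0 y0 z0 ell0] _ _] := path.
rewrite /A /energy_ac xT yT zT x0 y0 z0 ell0 S0 (half_pow_le0 _ (lexx 0)) !subrr.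
by rewrite !(mulr0, addr0, subr0); move: ellT; lra.
Qed.

Lemma Pxy_eq0 t : 0 <= t -> t <= T -> Pxy t = 0.
Proof.
have [p /andP[p0 pT] Pmax] := sup_Pxy; move: (erefl `|Pxy p|).
set M : R := {2}`|Pxy p| => MP.
have PM q : 0 <= q -> q <= T -> `|Pxy q| <= M by exact: Pmax.
have M0' : 0 <= M by rewrite /M.
move=> t0 tT; apply/eqP; rewrite -normr_le0; apply: le_trans (PM _ t0 tT) _.
move: M0'; rewrite le_eqVlt => /predU1P[<-//|M0]; exfalso.
have [_ h2 h3 h4] := small_radius_le r0 hr.
have M2 : M <= 2 * r ^+ 2 by exact: Pxy_le.
have r2 : r ^+ 2 <= r by rewrite expr2; move: r1 r0 => ? ?; nra.
have M1 : M <= 1 by move: r1; lra.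
(* The shift by [M] under the root keeps [f] continuous and bounded across y = 0. *)
pose f (q : R) := 2 * calib_const k ^+ 2 * M / Num.sqrt (M + `|q|).
have Mq (q : R) : 0 < M + `|q| by rewrite ltr_wpDr.
have cf : continuous f.
  move=> q; apply: cvgM; first exact: cvg_cst.
  apply: cvgV; first by rewrite gt_eqF// sqrtr_gt0.
  have cM : M + `|u| @[u --> q] --> M + `|q|.
    by apply: cvgD; [exact: cvg_cst|exact: norm_continuous].
  exact: (cvg_comp _ _ cM (@sqrt_continuous R _)).
have [F F0 dF'] := antiderivative ltr01 cf.
have dF (q : R) : `|q| < 1 -> is_derive q 1 F (f q).
  by rewrite ltr_norml => /andP[]; exact: dF'.
have f0 q : 0 <= f q.
  by rewrite divr_ge0 ?sqrtr_ge0// mulr_ge0 ?(ltW M0)// mulr_ge0 ?sqr_ge0.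
have f12 q : f q <= 12^-1.
  rewrite /f ler_pdivrMr ?sqrtr_gt0//.
  have sM : Num.sqrt M <= Num.sqrt (M + `|q|) by rewrite ler_sqrt ?lerDl// ltW.
  have sM2 : Num.sqrt M ^+ 2 = M by rewrite sqr_sqrtr// ltW.
  have sM0 := sqrtr_ge0 M.
  have sMr : Num.sqrt M <= 2 * r by apply: le_of_sqr; [lra|rewrite sM2; nra].
  have h5 : calib_const k ^+ 2 * Num.sqrt M <= calib_const k ^+ 2 * (2 * r) by rewrite ler_wpM2l ?sqr_ge0.
  have h6 : calib_const k ^+ 2 * M <= 125^-1 * Num.sqrt M.
    by rewrite -{1}sM2 expr2 mulrA; apply: ler_wpM2r => //; lra.
  lra.
pose s : R := (12 * M ^+ 2)^-1.
have s0 : 0 <= s by rewrite invr_ge0 mulr_ge0 ?sqr_ge0.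
have sM : s * M ^+ 2 <= 12^-1.
  by rewrite /s le_eqVlt; apply/orP; left; apply/eqP; field; rewrite gt_eqF.
have young q : 0 <= q -> q <= T ->
    dcalib1 k (y q) * (x q - half_pow k.+2 (y q)) <= f (y q) + s * Pxy q ^+ 2.
  move=> q0 qT.
  have y1 : `|y q| <= 1 by apply: (le_trans (yr q0 qT)); move: r1; lra.
  have := @calib_young _ k (y q) (x q - half_pow k.+2 (y q)) M M0 M1 y1.
  by rewrite subrK; apply; exact: PM.
have acA := ac_energy s path r0 hr xr yr dS dF f0 f12.
have dA := energy_derive path r0 hr xr yr dS dF f0 f12 s0 sM PM young.
pose A := energy_ac k s x y z S F.
pose DE := A T + 2 * ell T - (A 0 + 2 * ell 0).
have cube : M ^+ 3 <= 15 * ((4 + k.+2.*2.+1%:R) * r) * M ^+ 2 * DE.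
  by have := cube_le acA PM dA p0 pT; rewrite MP.
have gap : DE <= 2 * (F e - F 0) by exact: energy_gap.
(* For q >= 0, 4 C^2 M sqrt (M + q) is a primitive of [f], so it differs from [F] by a constant
   there. *)
have FF : F e - F 0 <= 4 * calib_const k ^+ 2 * M.
  pose H q := F q - 4 * calib_const k ^+ 2 * M * Num.sqrt (M + q).
  have dH q : 0 <= q -> q <= e -> is_derive q 1 H 0.
    move=> q0 qe.
    have q1 : `|q| < 1 by rewrite ger0_norm//; move: r1; rewrite /r; lra.
    have Mq0 : 0 < M + q by rewrite ltr_wpDr.
    have dM : is_derive q 1 (fun u => M + u) (0 + 1).
      exact: deriv_add (is_derive_id q 1).
    have := deriv_sub (dF _ q1) (deriv_scale (4 * calib_const k ^+ 2 * M)
      (@deriv_comp _ Num.sqrt (fun u => M + u) _ _ _ (is_derive1_sqrt Mq0) dM)).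
    move/is_derive_eq; apply; rewrite /f ger0_norm// add0r mulr1.
    by field; rewrite gt_eqF// sqrtr_gt0.
  have HH : H e - H 0 = 0.
    have := deriv_increment_bound (c := 0) (K := 0) (ltW e0) dH.
    rewrite !mul0r [H e - _ - 0]subr0 => h; apply/eqP; rewrite -normr_le0.
    by apply: h => q _ _; rewrite subrr normr0.
  rewrite /H addr0 in HH.
  have sM0 := sqrtr_ge0 M.
  have sMe : Num.sqrt (M + e) <= 1.
    rewrite -[leRHS]sqrtr1 ler_sqrt//; move: r1.
    by have : 500 * (2 * e) <= 1 := r1; lra.
  have CM : 0 <= 4 * calib_const k ^+ 2 * M by rewrite mulr_ge0 ?(ltW M0)// mulr_ge0 ?sqr_ge0.
  have h5 : 4 * calib_const k ^+ 2 * M * (Num.sqrt (M + e) - Num.sqrt M) <=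
      4 * calib_const k ^+ 2 * M * 1 by rewrite ler_wpM2l//; lra.
  lra.
have kM : 0 <= 15 * ((4 + k.+2.*2.+1%:R) * r) * M ^+ 2.
  apply: mulr_ge0; last exact: sqr_ge0.
  by apply: mulr_ge0 => //; apply: mulr_ge0 => //; exact: addr_ge0.
have DE8 : DE <= 8 * calib_const k ^+ 2 * M by lra.
(* This reads M^3 <= 120 (4 + m) r C^2 M^3, where [small_radius] makes the factor at most 120/500:
   impossible for M > 0. *)
have := le_trans cube (ler_wpM2l kM DE8).
have -> : 15 * ((4 + k.+2.*2.+1%:R) * r) * M ^+ 2 * (8 * calib_const k ^+ 2 * M) =
  120 * ((4 + k.+2.*2.+1%:R) * r * calib_const k ^+ 2) * M ^+ 3 by ring.
rewrite -[X in X <= _]mul1r ler_pM2r ?exprn_gt0//.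
move: h4; move: ((4 + k.+2.*2.+1%:R) * r * calib_const k ^+ 2) => Q; lra.
Qed.

(** With P = 0, w is 0 or - 2 h where y > 0, and a' = 0 elsewhere, so [young] holds with F = 0 and s
    = 0. The gain of [E] is then nonpositive while [E] is nondecreasing: [E] is constant, which
    makes [y] monotone, and M = 0 makes [z] monotone between equal end values. *)
Lemma rigidity_of_curve : [/\ ell T = S e,
  forall u v, 0 <= u -> u <= v -> v <= T -> y u <= y v &
  forall t, 0 <= t -> t <= T -> [/\ 0 <= y t, x t = half_pow k.+2 (y t) & z t = 0]].
Proof.
have [T0 [acx acy acz] [x0 y0 z0 ell0] _ _] := path.
have P0 q : 0 <= q -> q <= T -> `|Pxy q| <= 0.
  by move=> q0 qT; rewrite Pxy_eq0// normr0.
have dF (q : R) : `|q| < 1 -> is_derive q 1 (fun=> 0 : R) (0 : R).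
  by move=> _; exact: is_derive_cst.
have young q : 0 <= q -> q <= T ->
    dcalib1 k (y q) * (x q - half_pow k.+2 (y q)) <= 0 + 0 * Pxy q ^+ 2.
  move=> q0 qT; rewrite mul0r addr0.
  have [yq|/ltW yq] := leP (y q) 0.
    by rewrite /dcalib1 half_pow_le0// mulr0 !mul0r.
  rewrite mulr_ge0_le0 ?dcalib1_ge0// subr_le0.
  apply: le_of_sqr; first exact: half_pow_ge0.
  by rewrite half_pow_sqr// -subr_le0 -/(Pxy q) Pxy_eq0.
have z12 : (0 : R) <= 12^-1 by [].
have sM : 0 * 0 ^+ 2 <= 12^-1 :> R by rewrite mul0r.
have acA := ac_energy 0 path r0 hr xr yr dS dF (fun=> lexx 0) (fun=> z12).
have dA := energy_derive path r0 hr xr yr dS dF (fun=> lexx 0) (fun=> z12) (lexx 0) sM P0 young.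
pose A := energy_ac k 0 x y z S (fun=> 0).
have gap : A T + 2 * ell T - (A 0 + 2 * ell 0) <= 0.
  by have := energy_gap 0 (fun=> 0); rewrite subrr mulr0.
have ndE u v : 0 <= u -> u <= v -> v <= T -> A u + 2 * ell u <= A v + 2 * ell v.
  exact: (energy_nondecreasing acA dA).
have ndy u v : 0 <= u -> u <= v -> v <= T -> y u <= y v.
  have aux (a0 au av aT yu yv : R) : aT - a0 <= 0 -> a0 <= au -> av <= aT ->
      2 * au + yu <= 2 * av + yv -> yu <= yv by move=> *; lra.
  move=> u0 uv vT; apply: aux gap (ndE _ _ (lexx 0) u0 (le_trans uv vT))
    (ndE _ _ (le_trans u0 uv) vT (lexx T)) _.
  exact: (second_coord_energy acA dA).
have y_ge0 t : 0 <= t -> t <= T -> 0 <= y t by move=> t0 tT; rewrite -y0 ndy.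
split => //.
  have h := ndE _ _ (lexx 0) (ltW T0) (lexx T).
  move: h; rewrite /A /energy_ac xT yT zT x0 y0 z0 ell0 S0 (half_pow_le0 _ (lexx 0)) !subrr.
  rewrite !(mulr0, addr0, subr0) => h.
  by apply/eqP; rewrite eq_le ellT /=; move: h; lra.
move=> t t0 tT; have yt := y_ge0 _ t0 tT; split => //.
  have sq q : 0 <= q -> q <= T -> x q ^+ 2 = half_pow k.+2 (y q) ^+ 2.
    move=> q0 qT; rewrite half_pow_sqr ?y_ge0//; apply/eqP.
    by rewrite -subr_eq0 -/(Pxy q) Pxy_eq0.
  (* On the branch x = - h(y) with y > 0, the path would still have to reach [x T > 0]. It would
     cross x = 0 at a later time, where y > 0 by monotonicity and yet x^2 = y^m. *)
  have /eqP := sq t t0 tT; rewrite eqf_sqr => /orP[/eqP//|/eqP xt].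
  have h0 := half_pow_ge0 k.+2 (y t).
  have [yt0|yt0] := leP (y t) 0; first by rewrite xt half_pow_le0// oppr0.
  have hT : 0 < half_pow k.+2 e by rewrite mulr_gt0 ?exprn_gt0 ?sqrtr_gt0.
  have ht : 0 < half_pow k.+2 (y t) by rewrite mulr_gt0 ?exprn_gt0 ?sqrtr_gt0.
  have cx : {within `[t, T], continuous x}.
    by apply: ac_within_continuous; exact: ac_sub acx.
  have [|q] := IVT tT cx (v := 0).
    by rewrite xt xT ge_min le_max oppr_le0 h0 (ltW hT) orbT.
  rewrite in_itv/= => /andP[tq qT] xq.
  have := sq q (le_trans t0 tq) qT; rewrite xq expr0n/= => /esym/eqP.
  rewrite sqrf_eq0 /half_pow mulf_eq0 expf_eq0/= sqrtr_eq0.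
  have yq : 0 < y q by apply: lt_le_trans yt0 _; exact: ndy.
  by rewrite gt_eqF//= leNgt yq.
have h1 := third_coord_energy acA P0 dA (lexx 0) t0 tT.
have h2 := third_coord_energy acA P0 dA t0 tT (lexx T).
move: h1 h2; rewrite expr0n/= mulr0 !mul0r !add0r z0 zT => h1 h2.
by apply/eqP; rewrite eq_le h1 h2.
Qed.

End rigidity.

(** * The curve itself: horizontality, length and distance *)

Section curve.
Context {R : realType} (k : nat).
Let m := (k.+2).*2.+1.
Implicit Types (t u v : R).

Lemma gamma_barE t : 0 <= t -> gamma_bar m t = vec3 (half_pow k.+2 t) t 0.
Proof.
move=> t0; rewrite /gamma_bar; congr vec3.
have -> : m%:R / 2 = k.+2%:R + 2^-1 :> R.
  by rewrite /m -addn1 natrD -muln2 natrM; field.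
rewrite powRD; last first.
  by rewrite gt_eqF// addr_gt0.
by rewrite powR_mulrn// powR12_sqrt.
Qed.

(** [gamma_bar] is identified with [half_pow] for t >= 0 only, so the two-sided derivative at 0 is
    left aside; a single point affects neither length nor horizontality. *)
Lemma curve_derive t : 0 < t ->
  is_derive t 1 (gamma_bar m) (vec3 (slope k t) 1 0).
Proof.
move=> t0.
have dx : is_derive t 1 (fun s => half_pow k.+2 s) (slope k t) by exact: height_derive.
apply: (@near_eq_is_derive _ _ _ (fun s : R => vec3 (half_pow k.+2 s) s 0)).
  by near=> s; rewrite gamma_barE// ltW//; near: s; exact: lt_nbhsr.
pose c (s : R) := vec3 (half_pow k.+2 s) s 0.
have c0 : (fun s => c s 0 0) = half_pow k.+2 by apply/funext => s; rewrite vec3_0.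
have c1 : (fun s => c s 0 1) = id by apply/funext => s; rewrite vec3_1.
have c2 : (fun s => c s 0 ord_max) = cst 0 by apply/funext => s; rewrite vec3_2.
have dc : derivable c t 1.
  apply/derivable_mxP => i j; rewrite (ord1 i).
  case: j => -[|[|[|//]]] j3.
  - rewrite (_ : Ordinal j3 = 0); last exact: val_inj.
    by rewrite c0.
  - rewrite (_ : Ordinal j3 = 1); last exact: val_inj.
    by rewrite c1.
  - rewrite (_ : Ordinal j3 = ord_max); last exact: val_inj.
    by rewrite c2.
split => //; rewrite derive_mx//; apply: row3P; rewrite mxE.
- by rewrite c0 vec3_0; case: dx.
- by rewrite c1 vec3_1 derive_id.
- by rewrite c2 vec3_2 derive_cst.
Unshelve. all: by end_near. Qed.

Lemma curve_velocity t : 0 < t ->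
  vec3 (slope k t) 1 0 = slope k t *: X1 (gamma_bar m t) + 1 *: X2 m (gamma_bar m t).
Proof.
move=> t0; rewrite gamma_barE ?(ltW t0)// /X1 /X2 /P vec3_0 vec3_1 half_pow_sqr ?(ltW t0)//.
by apply: row3P; rewrite !mxE/=; ring.
Qed.

Lemma sr_norm_curve t : 0 < t ->
  sr_norm X1 (X2 m) (gamma_bar m t) (derive1 (gamma_bar m) t) = arc_speed k t.
Proof.
move=> t0; rewrite derive1E.
have [_ ->] := curve_derive t0; rewrite curve_velocity//.
rewrite (sr_normE m (gamma_bar m t) (slope k t, 1))/= /arc_speed expr1n.
by rewrite addrC.
Qed.

Section length.
Context (e : R) (S : R -> R) (e0 : 0 < e) (hr : small_radius k (2 * e))
  (dS : forall q : R, `|q| < 1 -> is_derive q 1 S (arc_speed k q)) (S0 : S 0 = 0).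

Let e1 : e < 1.
Proof.
have r0 : 0 <= 2 * e by rewrite mulr_ge0// ltW.
by have [+ _ _ _] := small_radius_le r0 hr; move: e0; lra.
Qed.

Lemma sr_length_curve t : 0 <= t -> t <= e ->
  sr_length X1 (X2 m) t (gamma_bar m) = (S t)%:E.
Proof.
rewrite le_eqVlt => /predU1P[<- _|t0 te].
  by rewrite /sr_length set_itv1 integral_set1 S0.
have speedE : {in `]0, t[%classic, (fun s => (arc_speed k s)%:E) =1
    (fun s => (sr_norm X1 (X2 m) (gamma_bar m s) (derive1 (gamma_bar m) s))%:E)}.
  by move=> s; rewrite inE/= in_itv/= => /andP[s0 _]; rewrite sr_norm_curve.
have marc : measurable_fun `]0, t[ (fun s => (arc_speed k s)%:E).
  apply/measurable_EFinP; apply: measurable_funTS.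
  by apply: continuous_measurable_fun; exact: arc_speed_continuous.
(* The open interval drops 0, where the velocity of [gamma_bar] is not computed. The closed interval
   returns once the integrand is the continuous [arc_speed]. *)
rewrite /sr_length integral_itv_bndoo; last exact: eq_measurable_fun marc.
transitivity (\int[mu]_(s in `]0%R, t[) (arc_speed k s)%:E)%E.
  by apply: eq_integral => s ts; rewrite -speedE.
rewrite -(integral_itv_bndoo true false)//.
have dS' s : 0 <= s -> s <= t -> is_derive s 1 S (arc_speed k s).
  by move=> s0 st; apply: dS; rewrite ger0_norm//; move: e1; lra.
rewrite (@continuous_FTC2 _ _ S)// ?S0 ?sube0//.
- exact/continuous_subspaceT/arc_speed_continuous.
- split.
  + move=> s; rewrite in_itv/= => /andP[s0 st].
    by have [] := dS' s (ltW s0) (ltW st).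
  + by apply: cvg_at_right_filter; exact: deriv_continuous (dS' 0 (lexx 0) (ltW t0)).
  + by apply: cvg_at_left_filter; exact: deriv_continuous (dS' t (ltW t0) (lexx t)).
- move=> s; rewrite in_itv/= => /andP[s0 st]; rewrite derive1E.
  by have [] := dS' s (ltW s0) (ltW st).
Qed.

Lemma horizontal_curve : horizontal X1 (X2 m) e (gamma_bar m).
Proof.
have r0 : 0 <= 2 * e by rewrite mulr_ge0// ltW.
split => //.
- apply: (ac_lipschitz (K := 1)) => u v u0 uv ve.
  rewrite !gamma_barE ?(le_trans u0)// mul1r.
  rewrite [leLHS]/Num.Def.normr/= mx_normrE.
  apply: bigmax_le => [|[i j] _]; first by rewrite subr_ge0.
  rewrite (ord1 i)/= !mxE.
  case: j => -[|[|[|//]]] j3 /=.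
  + have := @deriv_increment_bound _ (half_pow k.+2) (slope k) u v 0 1 uv.
    rewrite mul0r subr0 mul1r; apply => s us sv; first exact: height_derive.
    rewrite subr0 ger0_norm ?slope_ge0//.
    have sr : `|s| <= 2 * e by rewrite ger0_norm; [move: e0; lra|exact: le_trans us].
    by have := slope_small r0 hr sr; lra.
  + by rewrite ger0_norm// subr_ge0.
  + by rewrite subrr normr0 subr_ge0.
- apply: ae_imply (ae_neq 0) => t tn0; rewrite in_itv/= => /andP[t0 te].
  have {}t0 : 0 < t by rewrite lt_neqAle eq_sym tn0.
  have [dc vc] := curve_derive t0; split => //.
  exists (slope k t, 1) => /=; rewrite derive1E vc.
  exact: curve_velocity.
Qed.

(** The curve is a graph over its second coordinate, so the second coordinate of the path is itself
    the change of parameter. *)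
Lemma horizontal_path_rigidity (T : R) (c : R -> 'rV[R]_3) :
  horizontal X1 (X2 m) T c -> joins T c (gamma_bar m 0) (gamma_bar m e) ->
  (sr_length X1 (X2 m) T c <= (S e)%:E)%E ->
  sr_length X1 (X2 m) T c = (S e)%:E /\ reparametrization T c e (gamma_bar m).
Proof.
move=> hc [c0 cT] lenle.
have lenfin : (sr_length X1 (X2 m) T c < +oo)%E by apply: le_lt_trans lenle (ltry _).
have [ell [ell0 ndell elllen dc]] := arc_length_function hc lenfin.
have [T0 acc _] := hc.
have acci (i : 'I_3) : absolutely_continuous 0 T (fun s => c s 0 i).
  exact: ac_coord.
have h0 : half_pow k.+2 0 = 0 :> R by rewrite half_pow_le0.
rewrite gamma_barE// h0 in c0; rewrite gamma_barE ?(ltW e0)// in cT.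
have path : lifted_path k T (fun s => c s 0 0) (fun s => c s 0 1)
    (fun s => c s 0 ord_max) ell.
  by split => //; rewrite c0 vec3_0 vec3_1 vec3_2.
have ellT : ell T <= S e by rewrite -lee_fin (le_trans elllen).
have [ellE ndy cE] := rigidity_of_curve path e0 hr dS S0
  (etrans (congr1 (fun w : 'rV[R]_3 => w 0 0) cT) (vec3_0 _ _ _))
  (etrans (congr1 (fun w : 'rV[R]_3 => w 0 1) cT) (vec3_1 _ _ _))
  (etrans (congr1 (fun w : 'rV[R]_3 => w 0 ord_max) cT) (vec3_2 _ _ _)) ellT.
split; first by apply/eqP; rewrite eq_le lenle -ellE.
exists (fun s => c s 0 1); split => //.
- move=> s t; rewrite !in_itv/= => /andP[s0 _] /andP[_ tT] st; exact: ndy.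
- by rewrite c0 vec3_1.
- by rewrite cT vec3_1.
- move=> t; rewrite in_itv/= => /andP[t0 tT]; have [yt xt zt] := cE t t0 tT.
  by rewrite gamma_barE//; apply: row3P; rewrite ?vec3_0 ?vec3_1 ?vec3_2.
Qed.

Lemma sr_distance_curve :
  sr_distance X1 (X2 m) (gamma_bar m 0) (gamma_bar m e) = (S e)%:E.
Proof.
apply/eqP; rewrite eq_le; apply/andP; split.
  apply: ereal_inf_lbound; exists e, (gamma_bar m); split => //.
    exact: horizontal_curve.
  by rewrite sr_length_curve// ltW.
apply: le_ereal_inf_tmp => _ [T [c [hc jc ->]]].
have [/ltW//|lenle] := ltP (S e)%:E (sr_length X1 (X2 m) T c).
by have [-> _] := horizontal_path_rigidity hc jc lenle.
Qed.

End length.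
End curve.

(** * Functions of class C^k on a segment *)

Section smoothness_on_segment.
Context {R : realType}.

Lemma within_continuousP (V : normedModType R) (a b : R) (f : R -> V) :
  {within `[a, b], continuous f} <->
  forall x, a <= x <= b -> forall e, 0 < e -> exists2 d, 0 < d &
    forall y, a <= y <= b -> `|y - x| < d -> `|f y - f x| <= e.
Proof.
split.
  move=> /subspace_continuousP fc x xab e e0.
  have xab' : `[a, b]%classic x by rewrite /= in_itv.
  have /cvgrPdist_le/(_ _ e0) := fc x xab'.
  rewrite near_withinE => -[d /= d0 H]; exists d => // y yab xy.
  by rewrite distrC; apply: H; rewrite /ball_/= ?in_itv// distrC.
move=> H; apply/subspace_continuousP => x /=; rewrite in_itv/= => xab.
apply/cvgrPdist_le => e e0; have [d d0 K] := H x xab e e0.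
rewrite near_withinE; exists d => //= y xy; rewrite in_itv/= => yab.
by rewrite distrC; apply: K => //; rewrite distrC.
Qed.

(** Free of quotients, this form also allows [y = x], as composition requires when the inner
    function repeats a value. *)
Lemma derivative_withinP (V : normedModType R) (a b : R) (f : R -> V) (x : R) (l : V) :
  has_derivative_within a b f x l <->
  forall e, 0 < e -> exists2 d, 0 < d & forall y, a <= y <= b -> `|y - x| < d ->
    `|f y - f x - (y - x) *: l| <= e * `|y - x|.
Proof.
have quot y : y != x -> `|f y - f x - (y - x) *: l| =
    `|l - (y - x)^-1 *: (f y - f x)| * `|y - x|.
  move=> yx; have yx0 : y - x != 0 by rewrite subr_eq0.
  rewrite mulrC -normrZ scalerBr scalerA mulfV// scale1r distrC.
  by rewrite -opprB normrN distrC.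
split.
  move=> /cvgrPdist_le H e e0; have := H e e0.
  rewrite near_withinE => -[d /= d0 K]; exists d => // y yab xy.
  have [->|yx] := eqVneq y x; first by rewrite !subrr scale0r subrr !normr0 mulr0.
  by rewrite quot// ler_wpM2r//; apply: K => //=; rewrite ?in_itv// distrC.
move=> H; apply/cvgrPdist_le => e e0; have [d d0 K] := H e e0.
rewrite near_withinE; exists d => //= y xy yx; rewrite in_itv/= => yab.
have yx' : `|y - x| < d by rewrite distrC.
by have := K y yab yx'; rewrite quot// ler_pM2r// normr_gt0 subr_eq0.
Qed.

Lemma is_derive_within (a b : R) (f : R -> R) (x l : R) :
  is_derive x 1 f l -> has_derivative_within a b f x l.
Proof.
move=> df; apply/derivative_withinP => e e0.
have [d d0 H] := is_derive_increment df e0; exists d => // y _ yx.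
by rewrite (_ : (y - x) *: l = l * (y - x)); [exact: H|exact: mulrC].
Qed.

(** As [a < b], other points of the segment approach [x] from at least one side. This turns the
    existential derivative of [class_C] into the explicit one in [half_pow_not_class_C]. *)
Lemma derivative_within_unique (V : normedModType R) (a b x : R) (f : R -> V) (l1 l2 : V) :
  a < b -> a <= x <= b ->
  has_derivative_within a b f x l1 -> has_derivative_within a b f x l2 -> l1 = l2.
Proof.
move=> ab /andP[ax xb] /derivative_withinP H1 /derivative_withinP H2.
apply/eqP; rewrite -subr_eq0 -normr_le0; apply/ler_addgt0Pr => e e0; rewrite add0r.
have e20 : 0 < e / 2 by rewrite divr_gt0.
have [d1 d10 K1] := H1 _ e20; have [d2 d20 K2] := H2 _ e20.
pose d := Num.min d1 d2.
have d0 : 0 < d by rewrite lt_min d10.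
have [y [yab yx yd]] : exists y, [/\ a <= y <= b, y != x & `|y - x| < d].
  have [xb'|bx] := ltP x b.
    exists (Num.min b (x + d / 2)); rewrite /Num.min; case: ifPn => h.
      rewrite (le_trans ax xb) lexx gt_eqF//; split => //.
      by rewrite gtr0_norm ?subr_gt0//; move: h d0; lra.
    rewrite -leNgt in h; rewrite h (le_trans ax) ?lerDl ?divr_ge0 ?(ltW d0)//.
    rewrite addrC addrK gtr0_norm ?divr_gt0//.
    by split => //; [rewrite gt_eqF// ltrDr divr_gt0|move: d0; lra].
  have {ax xb bx} xE : x = b by apply/eqP; rewrite eq_le xb.
  exists (Num.max a (x - d / 2)); rewrite /Num.max xE; case: ifPn => h.
    rewrite (ltW h) lerBlDr lerDl divr_ge0 ?(ltW d0)//; split => //.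
      by rewrite lt_eqF// ltrBlDr ltrDl divr_gt0.
    by rewrite addrC addKr normrN gtr0_norm ?divr_gt0//; move: d0; lra.
  rewrite -leNgt in h; rewrite lexx (ltW ab) lt_eqF//; split => //.
  by rewrite distrC gtr0_norm ?subr_gt0//; move: h d0; lra.
have yx0 : 0 < `|y - x| by rewrite normr_gt0 subr_eq0.
move: yd; rewrite lt_min => /andP[/(K1 _ yab) h1 /(K2 _ yab) h2].
rewrite -(ler_pM2r yx0) mulrC -normrZ.
have -> : (y - x) *: (l1 - l2) =
    (f y - f x - (y - x) *: l2) - (f y - f x - (y - x) *: l1).
  by rewrite opprB [RHS]addrC addrA subrK scalerBr.
by apply: (le_trans (ler_normB _ _)); apply: (le_trans (lerD h2 h1)); lra.
Qed.

Lemma derivative_within_lipschitz (V : normedModType R) (a b x : R) (f : R -> V) (l : V) :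
  has_derivative_within a b f x l -> exists2 d, 0 < d &
    forall y, a <= y <= b -> `|y - x| < d -> `|f y - f x| <= (1 + `|l|) * `|y - x|.
Proof.
move=> /derivative_withinP/(_ 1 ltr01)[d d0 H]; exists d => // y yab /(H _ yab) h.
rewrite mulrDl [`|l| * _]mulrC -normrZ -[f y - f x](subrK ((y - x) *: l)).
by apply: (le_trans (ler_normD _ _)); rewrite lerD2r.
Qed.

Lemma derivative_within_continuous (V : normedModType R) (a b : R) (f g : R -> V) :
  (forall x, x \in `[a, b] -> has_derivative_within a b f x (g x)) ->
  {within `[a, b], continuous f}.
Proof.
move=> df; apply/within_continuousP => x xab e e0.
have xab' : x \in `[a, b] by rewrite in_itv.
have [d d0 H] := derivative_within_lipschitz (df x xab').
have K0 : 0 < 1 + `|g x| by rewrite ltr_pwDl.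
exists (Num.min d (e / (1 + `|g x|))); first by rewrite lt_min d0 divr_gt0.
move=> y yab; rewrite lt_min => /andP[/(H _ yab) h]; rewrite ltr_pdivlMr// => /ltW.
by apply: le_trans; rewrite mulrC.
Qed.

Lemma derivative_withinD (V : normedModType R) (a b : R) (f g : R -> V) (x : R) (l1 l2 : V) :
  has_derivative_within a b f x l1 -> has_derivative_within a b g x l2 ->
  has_derivative_within a b (fun t => f t + g t) x (l1 + l2).
Proof.
move=> /derivative_withinP H1 /derivative_withinP H2; apply/derivative_withinP => e e0.
have e20 : 0 < e / 2 by rewrite divr_gt0.
have [d1 d10 K1] := H1 _ e20; have [d2 d20 K2] := H2 _ e20.
exists (Num.min d1 d2); first by rewrite lt_min d10.
move=> y yab; rewrite lt_min => /andP[/(K1 _ yab) h1 /(K2 _ yab) h2].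
rewrite scalerDr [X in `|X|](_ : _ =
    (f y - f x - (y - x) *: l1) + (g y - g x - (y - x) *: l2)).
  by rewrite (le_trans (ler_normD _ _))// (le_trans (lerD h1 h2))//; lra.
by rewrite addrACA -opprD; congr (_ - _); rewrite opprD addrACA.
Qed.

Lemma le_div_mul (e c t : R) : 0 <= e -> 0 <= c -> 0 <= t ->
  e / (1 + c) * t * c <= e * t.
Proof.
move=> e0 c0 t0; have c1 : 0 < 1 + c by rewrite ltr_pwDl.
have -> : e / (1 + c) * t * c = e * t * (c / (1 + c)) by ring.
rewrite ler_piMr ?mulr_ge0// ler_pdivrMr// mul1r; lra.
Qed.

Lemma derivative_withinM (a b : R) (f g : R -> R) (x l1 l2 : R) :
  has_derivative_within a b f x l1 -> has_derivative_within a b g x l2 ->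
  has_derivative_within a b (fun t => f t * g t) x (l1 * g x + f x * l2).
Proof.
move=> df dg; have [d3 d30 K3] := derivative_within_lipschitz df.
have [d4 d40 K4] := derivative_within_lipschitz dg.
move: df dg => /derivative_withinP H1 /derivative_withinP H2.
apply/derivative_withinP => e e0.
pose K := (1 + `|l1|) * (1 + `|l2|).
have K0 : 0 < K by rewrite mulr_gt0// ltr_pwDl.
pose e3 := e / 3; have e30 : 0 < e3 by rewrite divr_gt0.
have g0 : 0 < 1 + `|g x| by rewrite ltr_pwDl.
have f0 : 0 < 1 + `|f x| by rewrite ltr_pwDl.
have [d1 d10 K1] := H1 _ (divr_gt0 e30 g0).
have [d2 d20 K2] := H2 _ (divr_gt0 e30 f0).
exists (Num.min (Num.min d1 d2) (Num.min (Num.min d3 d4) (e3 / K))).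
  by rewrite !lt_min d10 d20 d30 d40 divr_gt0.
move=> y yab; rewrite !lt_min => /andP[/andP[yd1 yd2] /andP[/andP[yd3 yd4]]].
rewrite ltr_pdivlMr// => /ltW h5.
have {yd1} h1 := K1 y yab yd1; have {yd2} h2 := K2 y yab yd2.
have {yd3} h3 := K3 y yab yd3; have {yd4} h4 := K4 y yab yd4.
have q1 : `|(f y - f x - (y - x) * l1) * g x| <= e3 * `|y - x|.
  rewrite normrM; apply: (le_trans (ler_wpM2r (normr_ge0 _) h1)).
  by apply: le_div_mul => //; exact: ltW.
have q2 : `|f x * (g y - g x - (y - x) * l2)| <= e3 * `|y - x|.
  rewrite mulrC normrM; apply: (le_trans (ler_wpM2r (normr_ge0 _) h2)).
  by apply: le_div_mul => //; exact: ltW.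
have q3 : `|(f y - f x) * (g y - g x)| <= e3 * `|y - x|.
  rewrite normrM; apply: (le_trans (ler_pM _ _ h3 h4)) => //.
  by rewrite mulrACA -/K mulrA ler_wpM2r// mulrC.
rewrite /GRing.scale/=.
have -> : f y * g y - f x * g x - (y - x) * (l1 * g x + f x * l2) =
    (f y - f x - (y - x) * l1) * g x + f x * (g y - g x - (y - x) * l2) +
    (f y - f x) * (g y - g x) by ring.
have -> : e * `|y - x| = e3 * `|y - x| + e3 * `|y - x| + e3 * `|y - x|.
  by rewrite /e3; field.
apply: (le_trans (ler_normD _ _)); apply: lerD => //.
by apply: (le_trans (ler_normD _ _)); exact: lerD.
Qed.

Lemma derivative_within_scale (V : normedModType R) (a b : R) (f : R -> R) (v : V)
    (x l : R) : has_derivative_within a b f x l ->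
  has_derivative_within a b (fun t => f t *: v) x (l *: v).
Proof.
move=> /derivative_withinP H; apply/derivative_withinP => e e0.
have v0 : 0 < 1 + `|v| by rewrite ltr_pwDl.
have [d d0 K] := H _ (divr_gt0 e0 v0); exists d => // y yab yd.
rewrite -scalerBl scalerA -scalerBl normrZ.
apply: (le_trans (ler_wpM2r (normr_ge0 _) (K y yab yd))).
by apply: le_div_mul => //; exact: ltW.
Qed.

Lemma derivative_within_coord (a b : R) (f : R -> 'rV[R]_3) (i : 'I_3) (x : R)
    (l : 'rV[R]_3) : has_derivative_within a b f x l ->
  has_derivative_within a b (fun t => f t 0 i) x (l 0 i).
Proof.
move=> /derivative_withinP H; apply/derivative_withinP => e /H[d d0 K].
exists d => // y yab yd; apply: le_trans (K y yab yd).
have -> : f y 0 i - f x 0 i - (y - x) *: l 0 i = (f y - f x - (y - x) *: l) 0 i.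
  by rewrite !mxE.
exact: coord_norm_le.
Qed.

Lemma derivative_within_comp (V : normedModType R) (a b c d : R) (f : R -> V)
    (g : R -> R) (x l1 : R) (l2 : V) : a <= x <= b ->
  (forall y, a <= y <= b -> c <= g y <= d) ->
  has_derivative_within a b g x l1 -> has_derivative_within c d f (g x) l2 ->
  has_derivative_within a b (fun t => f (g t)) x (l1 *: l2).
Proof.
move=> xab gcd dg; have [d3 d30 K3] := derivative_within_lipschitz dg.
move: dg => /derivative_withinP H1 /derivative_withinP H2.
apply/derivative_withinP => e e0.
pose K := 1 + `|l1|; have K0 : 0 < K by rewrite ltr_pwDl.
pose N := 1 + `|l2|; have N0 : 0 < N by rewrite ltr_pwDl.
have e20 : 0 < e / 2 by rewrite divr_gt0.
have [d1 d10 K1] := H1 _ (divr_gt0 e20 N0).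
have [d2 d20 K2] := H2 _ (divr_gt0 e20 K0).
exists (Num.min d1 (Num.min d3 (d2 / K))); first by rewrite !lt_min d10 d30 divr_gt0.
move=> y yab; rewrite !lt_min => /and3P[yd1 yd3]; rewrite ltr_pdivlMr// => yd2.
have {K1 yd1} h1 := K1 y yab yd1; have {K3 yd3} h3 := K3 y yab yd3.
have h2 : `|f (g y) - f (g x) - (g y - g x) *: l2| <= e / 2 / K * `|g y - g x|.
  by apply: K2; [exact: gcd|apply: (le_lt_trans h3); rewrite mulrC].
have -> : f (g y) - f (g x) - (y - x) *: (l1 *: l2) =
    (f (g y) - f (g x) - (g y - g x) *: l2) + (g y - g x - (y - x) *: l1) *: l2.
  by rewrite [X in _ = _ + X]scalerBl scalerA addrA subrK.
apply: (le_trans (ler_normD _ _)).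
have q1 : `|f (g y) - f (g x) - (g y - g x) *: l2| <= e / 2 * `|y - x|.
  apply: (le_trans h2); rewrite -[e / 2 / K * _]mulrA ler_wpM2l ?(ltW e20)//.
  by rewrite ler_pdivrMl.
have q2 : `|(g y - g x - (y - x) *: l1) *: l2| <= e / 2 * `|y - x|.
  rewrite normrZ; apply: (le_trans (ler_wpM2r (normr_ge0 _) h1)).
  by apply: le_div_mul => //; exact: ltW.
have -> : e * `|y - x| = e / 2 * `|y - x| + e / 2 * `|y - x| by field.
exact: (le_trans (lerD q1 q2)).
Qed.

End smoothness_on_segment.

Section class_C_theory.
Context {R : realType}.
Implicit Types (a b : R).

Lemma class_C_ext (V : normedModType R) n a b (f g : R -> V) :
  (forall x, a <= x <= b -> f x = g x) -> class_C n a b f -> class_C n a b g.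
Proof.
case: n => [|n] fg /=.
  move=> /within_continuousP H; apply/within_continuousP => x xab e e0.
  have [d d0 K] := H x xab e e0; exists d => // y yab yx.
  by rewrite -!fg//; exact: K.
move=> [f' df cf']; exists f' => // x xab; have := df x xab.
move=> /derivative_withinP H; apply/derivative_withinP => e e0.
have [d d0 K] := H e e0; exists d => // y yab yx.
by rewrite -!fg//; exact: K.
Qed.

Lemma class_CS (V : normedModType R) n a b (f : R -> V) :
  class_C n.+1 a b f -> class_C n a b f.
Proof.
elim: n f => [|n IH] f [g dg cg]; first exact: derivative_within_continuous dg.
by exists g => //; exact: IH.
Qed.

Lemma class_C_cst (V : normedModType R) n a b (v : V) : class_C n a b (fun=> v).
Proof.
elim: n v => [|n IH] v.
  apply/within_continuousP => x _ e e0; exists 1 => // y _ _.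
  by rewrite subrr normr0 ltW.
exists (fun=> 0); last exact: IH.
move=> x _; apply/derivative_withinP => e e0; exists 1 => // y _ _.
by rewrite scaler0 !subrr normr0 mulr_ge0 ?(ltW e0).
Qed.

Lemma class_CD (V : normedModType R) n a b (f g : R -> V) :
  class_C n a b f -> class_C n a b g -> class_C n a b (fun x => f x + g x).
Proof.
elim: n f g => [|n IH] f g /=.
  by move=> cf cg x; apply: cvgD; [exact: cf|exact: cg].
move=> [f' df cf] [g' dg cg]; exists (fun x => f' x + g' x); last exact: IH.
by move=> x xab; apply: derivative_withinD; [exact: df|exact: dg].
Qed.

Lemma class_CM n a b (f g : R -> R) :
  class_C n a b f -> class_C n a b g -> class_C n a b (fun x => f x * g x).
Proof.
elim: n f g => [|n IH] f g.
  by move=> /= cf cg x; apply: cvgM; [exact: cf|exact: cg].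
move=> cf cg; have cf0 := class_CS cf; have cg0 := class_CS cg.
move: cf cg => [f' df cf] [g' dg cg]; exists (fun x => f' x * g x + f x * g' x).
  by move=> x xab; apply: derivative_withinM; [exact: df|exact: dg].
by apply: class_CD; exact: IH.
Qed.

Lemma class_C_scale (V : normedModType R) n a b (f : R -> R) (v : V) :
  class_C n a b f -> class_C n a b (fun x => f x *: v).
Proof.
elim: n f => [|n IH] f /=; first by move=> cf x; apply: cvgZr_tmp; exact: cf.
move=> [f' df cf]; exists (fun x => f' x *: v); last exact: IH.
by move=> x xab; apply: derivative_within_scale; exact: df.
Qed.

Lemma class_C_coord n a b (f : R -> 'rV[R]_3) (i : 'I_3) :
  class_C n a b f -> class_C n a b (fun x => f x 0 i).
Proof.
elim: n f => [|n IH] f /=.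
  move=> /within_continuousP H; apply/within_continuousP => x xab e e0.
  have [d d0 K] := H x xab e e0; exists d => // y yab yx.
  apply: le_trans (K y yab yx); have := coord_norm_le (f y - f x) i.
  by rewrite !mxE.
move=> [f' df cf]; exists (fun x => f' x 0 i); last exact: IH.
by move=> x xab; apply: derivative_within_coord; exact: df.
Qed.

Lemma class_C_comp n a b c d (f g : R -> R) :
  (forall x, a <= x <= b -> c <= g x <= d) ->
  class_C n c d f -> class_C n a b g -> class_C n a b (fun x => f (g x)).
Proof.
move=> gcd; elim: n f => [|n IH] f.
  move=> /within_continuousP Hf /within_continuousP Hg.
  apply/within_continuousP => x xab e e0.
  have [d1 d10 K1] := Hf _ (gcd x xab) e e0.
  have d120 : 0 < d1 / 2 by rewrite divr_gt0.
  have [d2 d20 K2] := Hg x xab _ d120; exists d2 => // y yab yx.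
  apply: K1; first exact: gcd.
  by apply: (le_lt_trans (K2 y yab yx)); rewrite ltr_pdivrMr// ltr_pMr// ltr1n.
move=> [f' df cf] cg; have cg0 := class_CS cg; move: cg => [g' dg cg].
exists (fun x => g' x * f' (g x)).
  move=> x xab; have xab' : a <= x <= b by move: xab; rewrite in_itv.
  apply: (derivative_within_comp (l2 := f' (g x)) xab' gcd (dg x xab)).
  by apply: df; rewrite in_itv; exact: gcd.
by apply: class_CM => //; exact: IH.
Qed.

Lemma class_C_derive n a b (f f' : R -> R) :
  (forall x, a <= x <= b -> is_derive x 1 f (f' x)) ->
  class_C n a b f' -> class_C n.+1 a b f.
Proof.
move=> df cf'; exists f' => // x; rewrite in_itv/= => xab.
by apply: is_derive_within; exact: df.
Qed.

Lemma class_C_id n a b : class_C n a b (fun x : R => x).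
Proof.
apply: class_CS; apply: (@class_C_derive n a b _ (fun=> 1)).
exact: class_C_cst.
Qed.

Lemma class_CX n a b j : class_C n a b (fun x : R => x ^+ j).
Proof.
elim: j => [|j IH]; first exact: class_C_cst.
under eq_fun do rewrite exprS.
by apply: class_CM => //; exact: class_C_id.
Qed.

Lemma half_pow_class_C n a b : class_C n a b (@half_pow R n).
Proof.
elim: n => [|n IH]; first exact/continuous_subspaceT/half_pow_continuous.
apply: (@class_C_derive n a b _ (fun x => (n.+1%:R + 2^-1) * half_pow n x)) => [x _|].
  exact: half_pow_derive.
by apply: class_CM => //; exact: class_C_cst.
Qed.

(* The last derivative is a multiple of the square root, not derivable at [0]. *)
Lemma half_pow_not_class_C n (b : R) : 0 < b -> ~ class_C n.+1 0 b (@half_pow R n).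
Proof.
move=> b0; elim: n => [|n IH] [g dg cg].
  have x0 : (0 : R) \in `[0, b] by rewrite in_itv/= lexx ltW.
  have [d d0 H] := derivative_within_lipschitz (dg 0 x0).
  set K := 1 + _ in H; have K0 : 0 < K by rewrite ltr_pwDl.
  (* Differentiability at 0 would give sqrt s <= K s, hence 1 <= K^2 s; this witness makes K^2 s at
     most 1/2. *)
  pose s := Num.min (Num.min (d / 2) b) ((2 * K ^+ 2)^-1).
  have s0 : 0 < s by rewrite !lt_min b0 divr_gt0// invr_gt0 mulr_gt0// exprn_gt0.
  have sb : s <= b by rewrite !ge_min lexx orbT.
  have sd : s < d.
    rewrite (@le_lt_trans _ _ (d / 2))//; first by rewrite !ge_min lexx.
    by rewrite ltr_pdivrMr// ltr_pMr// ltr1n.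
  have sK : s <= (2 * K ^+ 2)^-1 by rewrite !ge_min lexx orbT.
  have := H s; rewrite subr0 (gtr0_norm s0) (ltW s0) sb => /(_ isT sd).
  rewrite [half_pow 0 0]half_pow_le0// subr0 ger0_norm ?half_pow_ge0//.
  rewrite /half_pow expr0 mul1r => h.
  have h2 : s <= (K * s) ^+ 2.
    rewrite -[X in X <= _](sqr_sqrtr (ltW s0)).
    by rewrite lerXn2r ?nnegrE ?sqrtr_ge0// mulr_ge0// ltW.
  have K20 : 0 < 2 * K ^+ 2 by rewrite mulr_gt0// exprn_gt0.
  move: sK; rewrite -(ler_pM2r K20) mulVf ?gt_eqF// => h3.
  have : s * 1 <= s * (K ^+ 2 * s).
    by rewrite mulr1 (_ : s * _ = (K * s) ^+ 2)//; ring.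
  by rewrite ler_pM2l// => h4; lra.
apply: IH; have c0 : n.+1%:R + 2^-1 != 0 :> R by rewrite gt_eqF// ltr_wpDl.
apply: (@class_C_ext _ _ _ _ (fun x => (n.+1%:R + 2^-1)^-1 * g x)); last first.
  by apply: class_CM => //; exact: class_C_cst.
move=> x xab; have xab' : x \in `[0, b] by rewrite in_itv.
rewrite (derivative_within_unique b0 xab (dg x xab')
  (is_derive_within _ _ (half_pow_derive n x))).
by rewrite mulKf.
Qed.

End class_C_theory.

(** * Regularity of the arc length parametrization *)

Section arc_length_regularity.
Context {R : realType} (k : nat) (e : R) (S : R -> R) (e0 : 0 < e)
  (hr : small_radius k (2 * e))
  (dS : forall q : R, `|q| < 1 -> is_derive q 1 S (arc_speed k q)) (S0 : S 0 = 0).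
Let m := (k.+2).*2.+1.

Let r0 : 0 <= 2 * e. Proof. by rewrite mulr_ge0// ltW. Qed.

Let e1 : e < 1.
Proof. by have [+ _ _ _] := small_radius_le r0 hr; move: e0; lra. Qed.

Let dS' t : 0 <= t <= e -> is_derive t 1 S (arc_speed k t).
Proof.
by move=> /andP[t0 te]; apply: dS; rewrite ger0_norm//; exact: le_lt_trans e1.
Qed.

Lemma arc_length_expand u v : 0 <= u -> u <= v -> v <= e -> v - u <= S v - S u.
Proof.
move=> u0 uv ve.
(* The speed lies in [1, 2], that is within 1/2 of 3/2; the lower end 1 is the one extracted. *)
have := @deriv_increment_bound _ S (arc_speed k) u v (3 / 2) 2^-1 uv.
move=> /(_ _ _)/ler_normlP[|x ux xv|+ _].
- by move=> x ux xv; apply: dS'; rewrite (le_trans u0 ux) (le_trans xv ve).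
- have x0 := le_trans u0 ux; have xe := le_trans xv ve.
  have xr : `|x| <= 2 * e by rewrite ger0_norm//; move: e0; lra.
  have a1 := arc_speed_ge1 k x; have a2 := arc_speed_small r0 hr xr.
  by rewrite ler_norml; apply/andP; split; lra.
- lra.
Qed.

(* On [0, e] the square of the speed is a polynomial, so the derivative of the
   inverse speed is a polynomial multiple of its cube. *)
Let p (t : R) : R := mbar k * calib_const k * t ^+ (k.+1).*2.

Lemma arc_speed_derive_pow (t : R) : 0 <= t ->
  is_derive t 1 (arc_speed k) (p t * calib2 k t).
Proof.
move=> t0; apply: is_derive_eq (arc_speed_derive k t) _.
rewrite /calib2 /slope half_powS; congr (_ * _).
have -> : mbar k * (t * half_pow k t) * (calib_const k * half_pow k t) =
  mbar k * calib_const k * (t * half_pow k t ^+ 2) :> R by ring.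
by rewrite half_pow_sqr// -exprS.
Qed.

Lemma calib2_derive_pow (t : R) : 0 <= t ->
  is_derive t 1 (calib2 k) (- (p t * (calib2 k t * (calib2 k t * calib2 k t)))).
Proof.
move=> t0; have s0 : arc_speed k t != 0 by rewrite gt_eqF// arc_speed_gt0.
apply: is_derive_eq (is_deriveV s0 (arc_speed_derive_pow t0)) _.
rewrite /GRing.scale/= /calib2; field; exact: s0.
Qed.

(** As for solutions of a differential equation, one derivative is gained at each step when the
    derivative is an expression in the function itself. *)
Lemma class_C_bootstrap a b (f f' : R -> R) :
  (forall x, a <= x <= b -> has_derivative_within a b f x (f' x)) ->
  (forall n, class_C n a b f -> class_C n a b f') ->
  forall n, class_C n a b f.
Proof.
move=> df ff'; elim=> [|n IH].
  by apply: (@derivative_within_continuous _ _ _ _ _ f') => x; rewrite in_itv; exact: df.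
by exists f'; [move=> x; rewrite in_itv; exact: df|exact: ff'].
Qed.

Lemma p_class_C n : class_C n 0 e p.
Proof. by apply: class_CM; [exact: class_C_cst|exact: class_CX]. Qed.

Lemma calib2_class_C n : class_C n 0 e (calib2 k).
Proof.
move: n; apply: (@class_C_bootstrap 0 e (calib2 k)
    (fun t => -1 * (p t * (calib2 k t * (calib2 k t * calib2 k t))))).
  move=> x /andP[x0 _]; apply: is_derive_within; rewrite mulN1r.
  exact: calib2_derive_pow.
move=> n cn; apply: class_CM; first exact: class_C_cst.
apply: class_CM; first exact: p_class_C.
by apply: class_CM => //; exact: class_CM.
Qed.

Lemma arc_length_class_C n : class_C n 0 e S.
Proof.
apply: class_CS; apply: (@class_C_derive _ n 0 e _ (arc_speed k)) => [x|]; first exact: dS'.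
move: n; apply: (@class_C_bootstrap 0 e (arc_speed k) (fun t => p t * calib2 k t)).
  by move=> x /andP[x0 _]; apply: is_derive_within; exact: arc_speed_derive_pow.
by move=> n _; apply: class_CM; [exact: p_class_C|exact: calib2_class_C].
Qed.

Lemma arc_length_image t : 0 <= t <= e -> 0 <= S t <= S e.
Proof.
move=> /andP[t0 te]; have := arc_length_expand (lexx 0) t0 te.
have := arc_length_expand t0 te (lexx e); rewrite S0; lra.
Qed.

Lemma arc_length_inj : {in `[0, e] &, injective S}.
Proof.
move=> u v; rewrite !in_itv/= => /andP[u0 ue] /andP[v0 ve] Suv.
apply/eqP; rewrite eq_le; apply/andP; split.
  have /orP[//|vu] := le_total u v.
  by have := arc_length_expand v0 vu ue; rewrite Suv; lra.
have /orP[//|uv] := le_total v u.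
by have := arc_length_expand u0 uv ve; rewrite Suv; lra.
Qed.

Definition arc_length_inv s := xget 0 [set t | 0 <= t <= e /\ S t = s].

Lemma arc_length_invP s : 0 <= s <= S e ->
  0 <= arc_length_inv s <= e /\ S (arc_length_inv s) = s.
Proof.
move=> /andP[s0 sL]; rewrite /arc_length_inv; case: xgetP => [t _ []//|].
have cS : {within `[0, e], continuous S} := arc_length_class_C 0.
have [|t] := IVT (ltW e0) cS (v := s).
  by rewrite S0 ge_min s0 le_max sL orbT.
by rewrite in_itv/= => te St /(_ t); case.
Qed.

Lemma arc_length_invK t : 0 <= t <= e -> arc_length_inv (S t) = t.
Proof.
move=> te; have [ie iS] := arc_length_invP (arc_length_image te).
by apply: arc_length_inj => //; rewrite in_itv.
Qed.

(** [arc_length_expand] makes the inverse 1-Lipschitz, so the first-order error of [S] at [t] passes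
    to the inverse, multiplied by [calib2], which is at most 1. *)
Lemma arc_length_inv_derive s : 0 <= s <= S e ->
  has_derivative_within 0 (S e) arc_length_inv s (calib2 k (arc_length_inv s)).
Proof.
move=> sL; have [tI tS] := arc_length_invP sL; set t := arc_length_inv s in tI tS *.
apply/derivative_withinP => d d0.
have [h h0 H] := is_derive_increment (dS' tI) d0; exists h => // s' sL' ss'.
have [tI' tS'] := arc_length_invP sL'; set t' := arc_length_inv s' in tI' tS' *.
have tt' : `|t' - t| <= `|s' - s|.
  rewrite -tS -tS'; move: tI tI' => /andP[t0 te] /andP[t0' te'].
  have [tt|/ltW tt] := leP t t'.
    by rewrite !ger0_norm ?subr_ge0//; have := arc_length_expand t0 tt te'; lra.
  rewrite distrC [leRHS]distrC.
  by rewrite !ger0_norm ?subr_ge0//; have := arc_length_expand t0' tt te; lra.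
have := H t' (le_lt_trans tt' ss'); rewrite tS tS' => {}H.
have a0 : arc_speed k t != 0 by rewrite gt_eqF// arc_speed_gt0.
have -> : t' - t - (s' - s) *: calib2 k t =
    - calib2 k t * (s' - s - arc_speed k t * (t' - t)).
  by rewrite /GRing.scale/= /calib2; field; exact: a0.
rewrite normrM normrN (le_trans _ (le_trans H _))//; last by rewrite ler_wpM2l// ltW.
rewrite ler_piMl// ger0_norm /calib2 ?invr_ge0 ?(ltW (arc_speed_gt0 _ _))//.
by rewrite invf_le1 ?arc_speed_gt0// arc_speed_ge1.
Qed.

Lemma arc_length_inv_class_C n : class_C n 0 (S e) arc_length_inv.
Proof.
move: n; apply: (class_C_bootstrap arc_length_inv_derive) => n cn.
apply: (class_C_comp _ (calib2_class_C n) cn) => s sL.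
by have [] := arc_length_invP sL.
Qed.

Lemma arc_length_reparametrization_regularity (sigma : R -> 'rV[R]_3) :
  (forall t, 0 <= t <= e -> sigma (S t) = gamma_bar m t) ->
  class_C k.+2 0 (S e) sigma /\ ~ class_C k.+3 0 (S e) sigma.
Proof.
move=> sig; split.
  apply: (@class_C_ext _ _ _ _ _ (fun s => half_pow k.+2 (arc_length_inv s) *: vec3 1 0 0 +
      arc_length_inv s *: vec3 0 1 0)).
    move=> s sL; have [tI tS] := arc_length_invP sL.
    rewrite -[in RHS]tS sig//; have /andP[t0 _] := tI; rewrite gamma_barE//.
    by apply: row3P; rewrite !mxE/= !(mulr0, mulr1, addr0, add0r).
  apply: class_CD; apply: class_C_scale; last exact: arc_length_inv_class_C.
  apply: (class_C_comp _ (half_pow_class_C k.+2 0 e) (arc_length_inv_class_C _)) => s sL.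
  by have [] := arc_length_invP sL.
move=> /(class_C_coord 0) c0; apply: (half_pow_not_class_C e0 (n := k.+2)).
apply: (@class_C_ext _ _ _ _ _ (fun t => sigma (S t) 0 0)).
  by move=> t te; have /andP[t0 _] := te; rewrite sig// gamma_barE// vec3_0.
exact: (class_C_comp arc_length_image c0 (arc_length_class_C _)).
Qed.

End arc_length_regularity.

(* For m odd, (m - 1)/2 = m/2 - 1/2 and (m + 1)/2 = m/2 + 1/2. *)
Theorem theorem1p1 (R : realType) (m : nat) (hm : (5 <= m)%N) (hodd : odd m) :
  \forall e \near (0 : R)^'+,
    let c : R -> 'rV[R]_3 := gamma_bar m in
    let L := sr_length X1 (X2 m) e c in
    let D := sr_distance X1 (X2 m) (c 0) (c e) in
    [/\ horizontal X1 (X2 m) e c /\ L = D,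
        forall (T : R) (c' : R -> 'rV[R]_3),
          horizontal X1 (X2 m) T c' ->
          joins T c' (c 0) (c e) ->
          sr_length X1 (X2 m) T c' = D ->
          reparametrization T c' e c,
        exists sigma : R -> 'rV[R]_3,
          arc_length_reparametrization X1 (X2 m) e c sigma &
        forall sigma : R -> 'rV[R]_3,
          arc_length_reparametrization X1 (X2 m) e c sigma ->
          class_C (m.-1)./2 0 (fine L) sigma /\
          ~ class_C (m.+1)./2 0 (fine L) sigma].
Proof.
have [k ->] : exists k, m = (k.+2).*2.+1.
  (* The truncated difference is exact because m >= 5. *)
  exists (m./2 - 2)%N; rewrite -(odd_double_half m) hodd add1n.
  by move: hm; rewrite -(odd_double_half m) hodd add1n; lia.
have [S S0 dS'] := antiderivative ltr01 (@arc_speed_continuous R k).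
have dS (q : R) : `|q| < 1 -> is_derive q 1 S (arc_speed k q).
  by rewrite ltr_norml => /andP[]; exact: dS'.
(* The bound of [small_radius] solved for [e]; the trailing 2 is that of the radius 2 e. *)
pose B : R := 500 * (4 + ((k.+2).*2.+1)%:R) * calib_const k ^+ 2 * 2.
have B0 : 0 < B.
  have C3 : 3 <= calib_const k :> R by exact: calib_const_ge3.
  rewrite /B; move: C3 (ler0n R (k.+2).*2.+1).
  move: (calib_const k : R) ((k.+2).*2.+1)%:R => C N C3 N0.
  have C2 : 0 < C ^+ 2 by rewrite exprn_gt0//; lra.
  have N4 : 0 < 4 + N by lra.
  by have := mulr_gt0 N4 C2; lra.
near=> e.
have e0 : 0 < e by [].
have hr : small_radius k (2 * e).
  have : e <= B^-1 by near: e; apply: nbhs_right_le; rewrite invr_gt0.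
  by rewrite -(ler_pM2l B0) mulfV ?gt_eqF// /B /small_radius !mulrA.
have lengthE t : 0 <= t -> t <= e ->
    sr_length X1 (X2 (k.+2).*2.+1) t (gamma_bar (k.+2).*2.+1) = (S t)%:E.
  by move=> t0 te; exact: (sr_length_curve e0 hr dS S0).
rewrite (lengthE e)// ?(ltW e0)// (sr_distance_curve e0 hr dS S0).
split.
- by split=> //; exact: horizontal_curve.
- move=> T c' hc' jc' lc'.
  have := horizontal_path_rigidity e0 hr dS S0 hc' jc'.
  by rewrite lc' => /(_ (lexx _))[].
- exists (fun s => gamma_bar (k.+2).*2.+1 (arc_length_inv e S s)) => t.
  rewrite in_itv/= => /andP[t0 te].
  by rewrite lengthE// (arc_length_invK e0 hr dS S0)// t0.
(* With m = 2 (k + 2) + 1 the two halves reduce to [k.+2] and [k.+3]. *)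
- move=> sigma asigma; rewrite /= doubleK.
  apply: (arc_length_reparametrization_regularity e0 hr dS S0) => t /andP[t0 te].
  by rewrite -asigma ?in_itv/= ?t0// lengthE.
Unshelve. all: by end_near. Qed.
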